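(* Let $f:\mathbb{R}^n\to(-\infty,+\infty]$ be partly smooth at the point $\bar x$ relative to the manifold $\mathcal M$, and prox-regular at $\bar x$, with $0\in\mathrm{ri}\,\partial f(\bar x)$. Suppose $x_k\to\bar x$ and $f(x_k)\to f(\bar x)$. Then $$x_k\in\mathcal M\ \text{ for all large } k\quad\text{if and only if}\quad \mathrm{dist}(0,\partial f(x_k))\to0.$$
   Context: $\mathrm{ri}$ denotes relative interior and $\mathrm{dist}$ the Euclidean distance from a point to a set. Smooth means $C^1$; the paper's convention is that a $C^1$ function is a differentiable function with Lipschitz continuous gradient (in particular, $C^2$ smoothness is not required in the definition of partial smoothness below). A set $\mathcal M$ is a manifold around $x$ if $x\in\mathcal M$ and there is an open set $V\ni x$ such that $\mathcal M\cap V=\{z\in V\mid \Psi(z)=0\}$, where $\Psi$ is a smooth map whose derivative is surjective throughout $V$. $N_{\mathcal M}(x)$ is the normal space to $\mathcal M$ at $x$. For $h:\mathbb{R}^n\to[-\infty,+\infty]$ finite at $x$: - subderivative: $dh(x)(\bar w)=\liminf_{\tau\downarrow0,\ w\to\bar w}\frac{h(x+\tau w)-h(x)}{\tau}$; - regular subdifferential: $\hat\partial h(x)=\{v\mid \liminf_{z\to x,\,z\neq x}\frac{h(z)-h(x)-\langle v,z-x\rangle}{\|z-x\|_2}\ge0\}$; - limiting subdifferential: $\partial h(x)=\{v\mid\exists\,x^r\to x,\ h(x^r)\to h(x),\ v^r\in\hat\partial h(x^r),\ v^r\to v\}$; - horizon subdifferential: $\partial^\infty h(x)=\{\lim_r\lambda_rv^r\mid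 v^r\in\partial h(x^r),\ x^r\to x,\ h(x^r)\to h(x),\ \lambda_r\downarrow0\}$; - when $\partial h(x)\ne\emptyset$, $h$ is regular at $x$ iff $h$ is locally lower semicontinuous at $x$, $\partial h(x)=\hat\partial h(x)$, and $\partial^\infty h(x)=\hat\partial h(x)^\infty$ (the recession cone of $\hat\partial h(x)$). Partly smooth: let $\mathcal M\subset\mathbb{R}^n$ contain $x$. A function $f$ is partly smooth at $x$ relative to $\mathcal M$ if $\mathcal M$ is a manifold around $x$ and (i) (restricted smoothness) the restriction $f|_{\mathcal M}$ is smooth around $x$ (i.e. agrees on $\mathcal M$ near $x$ with a smooth function defined near $x$); (ii) (regularity) at every point of $\mathcal M$ close to $x$, $f$ is regular and has a subgradient; (iii) (normal sharpness) $df(x)(-w)>-df(x)(w)$ for all nonzero $w\in N_{\mathcal M}(x)$; (iv) (subgradient continuity) the subdifferential map $\partial f$ is continuous at $x$ relative to $\mathcal M$. Given (i), this is equivalent to inner semicontinuity: for any sequence $x^r\in\mathcal M$ with $x^r\to x$ and any $y\in\partial f(x)$ there exist $y^r\in\partial f(x^r)$ with $y^r\to y$. Prox-regular: $f$ is prox-regular at $\bar x$ for $\bar v\in\partial f(\bar x)$ if $f$ is finite at $\bar x$, locally lower semicontinuous around $\bar x$, and there exists $\rho>0$ such that $f(x')\ge f(x)+\langle v,x'-x\rangle-\frac\rho2\|x'-x\|_2^2$ whenever $x,x'$ are near $\bar x$ with $f(x)$ near $f(\bar x)$ and $v\in\partial f(x)$ is near $\bar v$. It is prox-regular at $\bar x$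 if this holds for every $\bar v\in\partial f(\bar x)$. *)

(* Defs.v *)
(* MathComp-Analysis *)
From HB Require Import structures.
From mathcomp Require Import all_boot all_order all_algebra.
From mathcomp Require Import all_classical all_reals all_analysis.

Set Implicit Arguments.
Unset Strict Implicit.
Unset Printing Implicit Defensive.

Import Order.TTheory GRing.Theory Num.Theory.
Import numFieldNormedType.Exports.

Local Open Scope classical_set_scope.
Local Open Scope ring_scope.

Section Euclidean.
Variables (R : realType) (n : nat).
Implicit Types (x y u v : 'rV[R]_n) (C : set 'rV[R]_n).

(* The library norm `|x| on 'rV[R]_n is the sup norm (it induces the same
   topology); quantities that depend on the Euclidean structure use [dot] and
   [enorm]. *)
Definition dot u v : R := \sum_(i < n) u 0 i * v 0 i.

Definition enorm u : R := Num.sqrt (dot u u).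

(* The distance to the empty set is +oo. *)
Definition edist_to x C : \bar R := ereal_inf [set (enorm (y - x))%:E | y in C].

Definition affine_set C : Prop :=
  forall x y (t : R), C x -> C y -> C ((1 - t) *: x + t *: y).

Definition affine_hull C : set 'rV[R]_n := smallest affine_set C.

Definition relint C : set 'rV[R]_n :=
  [set x | C x /\ \forall z \near x, affine_hull C z -> C z].

(* Meant for nonempty C, in which case it is the usual recession cone. *)
Definition recession_cone C : set 'rV[R]_n :=
  [set w | forall x (t : R), C x -> 0 <= t -> C (x + t *: w)].

End Euclidean.

Section Subdifferentials.
Variables (R : realType) (n : nat).
Implicit Types (h : 'rV[R]_n -> \bar R) (x v w : 'rV[R]_n).

Definition subderivative h x w : \bar R :=
  limf_einf (fun p : R * 'rV[R]_n =>
               (h (x + p.1 *: p.2)%R - h x) * (p.1^-1)%:E)%E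
            (filter_prod 0^'+ (nbhs w)).

(* The three subdifferentials are empty at points where h is not finite. *)
Definition regular_subdiff h x : set 'rV[R]_n :=
  [set v | h x \is a fin_num /\
    (0 <= limf_einf (fun z : 'rV[R]_n =>
            (h z - h x - (dot v (z - x))%:E) * ((enorm (z - x))^-1)%:E)
          (x^'))%E].

Definition limiting_subdiff h x : set 'rV[R]_n :=
  [set v | h x \is a fin_num /\
    exists xs vs : nat -> 'rV[R]_n,
      [/\ xs r @[r --> \oo] --> x,
          h (xs r) @[r --> \oo] --> h x,
          forall r, regular_subdiff h (xs r) (vs r) &
          vs r @[r --> \oo] --> v]].

(* The scalars decrease to 0 in the sense: positive and tending to 0. *)
Definition horizon_subdiff h x : set 'rV[R]_n :=
  [set v | h x \is a fin_num /\
    exists (xs vs : nat -> 'rV[R]_n) (lam : nat -> R),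
      [/\ xs r @[r --> \oo] --> x /\ h (xs r) @[r --> \oo] --> h x,
          forall r, limiting_subdiff h (xs r) (vs r),
          (forall r, 0 < lam r) /\ lam r @[r --> \oo] --> 0 &
          lam r *: vs r @[r --> \oo] --> v]].

(* Local lower semicontinuity in the sense of Rockafellar and Wets,
   "Variational Analysis", Definition 1.33: it says that the epigraph of h is
   locally closed at (x, h x). *)
Definition locally_lsc h x : Prop :=
  h x \is a fin_num /\
  exists2 e : R, 0 < e & forall a : R, (a%:E <= h x + e%:E)%E ->
    closed [set z | enorm (z - x) <= e /\ (h z <= a%:E)%E].

(* Regularity at a point where h has a subgradient. *)
Definition regular_at h x : Prop :=
  [/\ locally_lsc h x,
      limiting_subdiff h x = regular_subdiff h x &
      horizon_subdiff h x = recession_cone (regular_subdiff h x)].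

Definition prox_regular_for h xbar vbar : Prop :=
  [/\ limiting_subdiff h xbar vbar, h xbar \is a fin_num, locally_lsc h xbar &
  exists2 rho : R, 0 < rho & exists2 d : R, 0 < d &
    forall x x' v, enorm (x - xbar) < d -> enorm (x' - xbar) < d ->
      (`|h x - h xbar| < d%:E)%E ->
      limiting_subdiff h x v -> enorm (v - vbar) < d ->
      (h x + (dot v (x' - x) - rho / 2 * enorm (x' - x) ^+ 2)%:E <= h x')%E].

Definition prox_regular h xbar : Prop :=
  forall vbar, limiting_subdiff h xbar vbar -> prox_regular_for h xbar vbar.

End Subdifferentials.

(* C^1 with the convention that C^1 includes Lipschitz continuity of the
   derivative (for the operator norm). *)
Definition smooth_on (R : realType) (n : nat) (W : normedModType R)
    (V : set 'rV[R]_n) (F : 'rV[R]_n -> W) : Prop :=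
  (forall z, V z -> differentiable F z) /\
  exists L : R, forall y z u, V y -> V z ->
    `|'d F y u - 'd F z u| <= L * `|y - z| * `|u|.

Section PartialSmoothness.
Variables (R : realType) (n : nat).
Implicit Types (f : 'rV[R]_n -> \bar R) (M : set 'rV[R]_n) (x : 'rV[R]_n).

Definition local_equation M x (m : nat) (V : set 'rV[R]_n)
    (Psi : 'rV[R]_n -> 'rV[R]_m) : Prop :=
  [/\ open V, V x, smooth_on V Psi,
      forall z, V z -> range ('d Psi z) = setT &
      M `&` V = [set z | V z /\ Psi z = 0]].

Definition manifold_around M x : Prop :=
  M x /\ exists (m : nat) V (Psi : 'rV[R]_n -> 'rV[R]_m),
           local_equation M x V Psi.

(* The orthogonal complement of the tangent space ker 'd Psi x, which does not
   depend on the choice of the local equation Psi. *)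
Definition normal_space_at M x : set 'rV[R]_n :=
  [set w | exists (m : nat) V (Psi : 'rV[R]_n -> 'rV[R]_m),
    local_equation M x V Psi /\ forall u, 'd Psi x u = 0 -> dot w u = 0].

Definition restricted_smooth f M x : Prop :=
  exists V (g : 'rV[R]_n -> R),
    [/\ open V, V x, smooth_on V g & forall z, M z -> V z -> f z = (g z)%:E].

Definition outer_semicontinuous (S : 'rV[R]_n -> set 'rV[R]_n) M x : Prop :=
  forall (xs ys : nat -> 'rV[R]_n) (y : 'rV[R]_n),
    (forall r, M (xs r)) -> xs r @[r --> \oo] --> x ->
    (forall r, S (xs r) (ys r)) -> ys r @[r --> \oo] --> y -> S x y.

Definition inner_semicontinuous (S : 'rV[R]_n -> set 'rV[R]_n) M x : Prop :=
  forall (xs : nat -> 'rV[R]_n) (y : 'rV[R]_n),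
    (forall r, M (xs r)) -> xs r @[r --> \oo] --> x -> S x y ->
    exists2 ys : nat -> 'rV[R]_n,
      \forall r \near \oo, S (xs r) (ys r) & ys r @[r --> \oo] --> y.

Definition setvalued_continuous (S : 'rV[R]_n -> set 'rV[R]_n) M x : Prop :=
  outer_semicontinuous S M x /\ inner_semicontinuous S M x.

Record partly_smooth f M x : Prop := PartlySmooth {
  ps_manifold : manifold_around M x ;
  ps_smooth : restricted_smooth f M x ;
  ps_regular : \forall z \near x, M z ->
    regular_at f z /\ limiting_subdiff f z !=set0 ;
  ps_sharp : forall w, normal_space_at M x w -> w != 0 ->
    (- subderivative f x w < subderivative f x (- w)%R)%E ;
  ps_continuous : setvalued_continuous (limiting_subdiff f) M x }.

End PartialSmoothness.

(* Main.v *)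
Require Import Defs.
From HB Require Import structures.
From mathcomp Require Import all_boot all_order all_algebra.
From mathcomp Require Import all_classical all_reals all_analysis.
From mathcomp Require Import ring lra.

Set Implicit Arguments.
Unset Strict Implicit.
Unset Printing Implicit Defensive.

Import Order.TTheory GRing.Theory Num.Theory.
Import numFieldNormedType.Exports.

Local Open Scope classical_set_scope.
Local Open Scope ring_scope.

(** The easy direction is inner semicontinuity of the subdifferential along M
    at the subgradient 0.

    For the converse, suppose that points z off M, with subgradients v -> 0,
    converge to xbar with f z -> f xbar.  Each z is moved to a point p of M so
    that z - p is normal to M at xbar (normal_projection); let w be a limit of
    the directions (z - p) / |z - p|, a unit normal.  Given u in the
    subdifferential C at xbar, inner semicontinuity supplies subgradients
    u' -> u at the points p.  If u is near 0, prox-regularity applies to the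
    two pairs (z, v) and (p, u') and makes the subdifferential almost monotone:
    <u' - v, z - p> is at most a multiple of |z - p|^2.  Dividing by |z - p|
    gives <u, w> <= 0 for all u in C near 0 (off_manifold_normal_direction),
    and since 0 is in the relative interior of C, w is orthogonal to C
    (relint0_orthogonal).

    Normal sharpness forbids this as soon as the subderivatives of f at xbar in
    the directions w and -w are both at most 0.  At a regular point the
    subderivative is the support function of the subdifferential; only the
    upper bound is needed, and only when the support function is at most 0 in
    the given direction (regular_subderivative_le0).  It is proved by
    contradiction.  If the subderivative at w is positive, f grows linearly on
    a small circular cone D with apex xbar around w.  Minimizing
      f z - (e / 2) <w, z - xbar> + k |z - p|^2,  z near xbar, p in D,
    with k large gives regular subgradients at points z near xbar whose inner
    product with w is at least a fixed fraction of 1 + |v|: the slope e / 2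
    gives the constant part, and the term - 2 k (z - p) of v, where z - p lies in
    the polar cone of D - xbar, gives the part proportional to |v|
    (steep_subgradients).  A limit of such subgradients, or of their rescalings
    if they are unbounded, is a limiting or a horizon subgradient having a
    positive inner product with w.

    The projection is Newton's method with the derivative frozen at xbar; it
    uses only strict differentiability of the local equation, so the Lipschitz
    continuity of its derivative is enough. *)

(** * Euclidean norm *)

Section EuclideanGeometry.
Variables (R : realType) (n : nat).
Implicit Types u v w x y z : 'rV[R]_n.

Lemma dotC u v : dot u v = dot v u.
Proof. by apply: eq_bigr => i _; rewrite mulrC. Qed.

Lemma dotDl u v w : dot (u + v) w = dot u w + dot v w.
Proof. by rewrite -big_split; apply: eq_bigr => i _; rewrite mxE mulrDl. Qed.

Lemma dotZl (a : R) u v : dot (a *: u) v = a * dot u v.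
Proof. by rewrite /dot mulr_sumr; apply: eq_bigr => i _; rewrite mxE mulrA. Qed.

Lemma dotDr u v w : dot w (u + v) = dot w u + dot w v.
Proof. by rewrite !(dotC w) dotDl. Qed.

Lemma dotZr (a : R) u v : dot u (a *: v) = a * dot u v.
Proof. by rewrite !(dotC u) dotZl. Qed.

Lemma dotNl u v : dot (- u) v = - dot u v.
Proof. by rewrite -scaleN1r dotZl mulN1r. Qed.

Lemma dotNr u v : dot u (- v) = - dot u v.
Proof. by rewrite !(dotC u) dotNl. Qed.

Lemma dot0l u : dot 0 u = 0.
Proof. by rewrite -(scale0r 0) dotZl mul0r. Qed.

Lemma dotBl u v w : dot (u - v) w = dot u w - dot v w.
Proof. by rewrite dotDl dotNl. Qed.

Definition dotE := (dotDl, dotDr, dotNl, dotNr, dotZl, dotZr).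

Lemma dot_ge0 u : 0 <= dot u u.
Proof. by apply: sumr_ge0 => i _; rewrite -expr2 sqr_ge0. Qed.

Lemma enorm_ge0 u : 0 <= enorm u. Proof. exact: sqrtr_ge0. Qed.

Lemma enorm_sqr u : enorm u ^+ 2 = dot u u.
Proof. by rewrite sqr_sqrtr ?dot_ge0. Qed.

Lemma enorm0 : enorm (0 : 'rV[R]_n) = 0.
Proof. by rewrite /enorm dot0l sqrtr0. Qed.

Lemma enormZ (a : R) u : enorm (a *: u) = `|a| * enorm u.
Proof. by rewrite /enorm dotZl dotZr mulrA -expr2 sqrtrM ?sqr_ge0// sqrtr_sqr. Qed.

Lemma enormN u : enorm (- u) = enorm u.
Proof. by rewrite -scaleN1r enormZ normrN1 mul1r. Qed.

Lemma enormB u v : enorm (u - v) = enorm (v - u).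
Proof. by rewrite -enormN opprB. Qed.

Lemma cauchy_schwarz u v : dot u v <= enorm u * enorm v.
Proof.
have [u0|u0] := eqVneq (dot u u) 0; last first.
  have up : 0 < dot u u by rewrite lt_neqAle eq_sym u0 dot_ge0.
  have := dot_ge0 (dot u u *: v - dot u v *: u).
  rewrite !dotE (dotC v u) => h.
  have {}h : 0 <= dot u u * (dot u u * dot v v - dot u v ^+ 2).
    by move: h; set a := dot u u; set b := dot v v; set c := dot u v; nra.
  rewrite pmulr_rge0// subr_ge0 in h.
  apply: (le_trans (ler_norm _)).
  rewrite -(ler_pXn2r (n:=2)) ?nnegrE ?mulr_ge0 ?enorm_ge0//.
  by rewrite real_normK ?num_real// exprMn !enorm_sqr.
have : forall i, u 0 i = 0.
  move=> i; move/eqP: u0; rewrite psumr_eq0; last first.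
    by move=> j _; rewrite -expr2 sqr_ge0.
  by move/allP => /(_ i); rewrite mem_index_enum -expr2 sqrf_eq0 => /(_ isT)/eqP.
move=> u00; rewrite (_ : dot u v = 0) ?mulr_ge0 ?enorm_ge0//.
by apply: big1 => i _; rewrite u00 mul0r.
Qed.

Lemma enormD u v : enorm (u + v) <= enorm u + enorm v.
Proof.
rewrite -(ler_pXn2r (n:=2)) ?nnegrE ?addr_ge0 ?enorm_ge0//.
rewrite sqrrD !enorm_sqr !dotE (dotC v u).
by have := cauchy_schwarz u v; lra.
Qed.

(** The ambient topology comes from the sup norm; this bound and
    [enorm_le_norm] let all neighbourhoods and limits be expressed with the
    Euclidean norm (see [nbhs_enorm] and [cvg_enormP]). *)
Lemma norm_le_enorm u : `|u| <= enorm u.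
Proof.
rewrite [`|u|]/Num.norm/= mx_normrE; apply/bigmax_leP.
split; first exact: enorm_ge0.
move=> [i j] _ /=; rewrite (ord1 i).
rewrite -(ler_pXn2r (n:=2)) ?nnegrE ?enorm_ge0//.
rewrite enorm_sqr real_normK ?num_real// /dot (bigD1 j)//= -expr2 lerDl.
by apply: sumr_ge0 => k _; rewrite -expr2 sqr_ge0.
Qed.

Lemma entry_le_norm u i : `|u 0 i| <= `|u|.
Proof.
by rewrite [leRHS]/Num.norm/= mx_normrE; apply/bigmax_geP; right; exists (0, i).
Qed.

Lemma enorm_le_norm u : enorm u <= n%:R * `|u|.
Proof.
rewrite -(ler_pXn2r (n:=2)) ?nnegrE ?enorm_ge0 ?mulr_ge0//.
rewrite enorm_sqr (@le_trans _ _ (\sum_(i < n) `|u| ^+ 2))//.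
  apply: ler_sum => i _; rewrite -expr2 -real_normK ?num_real//.
  by rewrite ler_pXn2r ?nnegrE// entry_le_norm.
rewrite sumr_const card_ord exprMn -(mulr_natl (`|u| ^+ 2)).
apply: ler_wpM2r; first exact: sqr_ge0.
by rewrite -natrX ler_nat; case: n => // k; rewrite leq_pmulr.
Qed.

Lemma enorm_eq0 u : enorm u = 0 -> u = 0.
Proof.
by move=> u0; apply/eqP; rewrite -normr_le0 -u0 norm_le_enorm.
Qed.

Lemma enorm_gt0 u : u != 0 -> 0 < enorm u.
Proof.
move=> u0; rewrite lt_neqAle enorm_ge0 andbT eq_sym.
by apply: contra u0 => /eqP/enorm_eq0 ->.
Qed.

Lemma dot_cvg (T : Type) (F : set_system T) {FF : Filter F}
    (g h : T -> 'rV[R]_n) u v :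
  g t @[t --> F] --> u -> h t @[t --> F] --> v ->
  dot (g t) (h t) @[t --> F] --> dot u v.
Proof.
move=> gu hv; rewrite /dot; apply: cvg_big => [|i _]; first exact: add_continuous.
have cvg_coord k z : k t @[t --> F] --> z -> (k t) 0 i @[t --> F] --> z 0 i.
  by move=> kz; exact: (cvg_comp _ _ kz (@coord_continuous R 1 n 0 i z)).
by apply: cvgM; exact: cvg_coord.
Qed.

Lemma enorm_cvg (T : Type) (F : set_system T) {FF : Filter F}
    (g : T -> 'rV[R]_n) u :
  g t @[t --> F] --> u -> enorm (g t) @[t --> F] --> enorm u.
Proof.
by move=> gu; apply: (cvg_comp _ _ (dot_cvg gu gu)); exact: sqrt_continuous.
Qed.

Lemma subl_continuous x : continuous (fun z : 'rV[R]_n => z - x).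
Proof.
by move=> z; apply: (@cvgB _ _ _ (nbhs z) _ id (fun=> x));
  [exact: cvg_id|exact: cvg_cst].
Qed.

Lemma enormB_continuous x : continuous (fun z : 'rV[R]_n => enorm (z - x)).
Proof. by move=> z; exact: (enorm_cvg (@subl_continuous x z)). Qed.

Lemma dotB_continuous x w : continuous (fun z : 'rV[R]_n => dot (z - x) w).
Proof. by move=> z; exact: (dot_cvg (@subl_continuous x z) (cvg_cst _)). Qed.

Lemma nbhs_enorm x (A : set 'rV[R]_n) :
  nbhs x A <-> exists2 e : R, 0 < e & forall z, enorm (z - x) < e -> A z.
Proof.
split=> [/nbhs_ballP[e /= e0 xA]|[e e0 xA]].
  exists e => // z zx; apply: xA; rewrite -ball_normE /= distrC.
  exact: le_lt_trans (norm_le_enorm _) zx.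
have : enorm (z - x) @[z --> x] --> enorm (x - x).
  exact: enormB_continuous.
rewrite subrr enorm0 => /cvgrPdist_lt/(_ e e0).
by apply: filterS => z; rewrite sub0r normrN ger0_norm ?enorm_ge0//; exact: xA.
Qed.

Lemma cvg_enormP (T : Type) (F : set_system T) {FF : Filter F}
    (g : T -> 'rV[R]_n) u :
  g t @[t --> F] --> u <->
  forall e : R, 0 < e -> \forall t \near F, enorm (g t - u) < e.
Proof.
split=> [gu e e0|gu A /nbhs_enorm[e e0 eA]].
  by apply: (gu [set z | enorm (z - u) < e]); apply/nbhs_enorm; exists e.
by apply: filterS (gu e e0) => t; exact: eA.
Qed.

Lemma compact_eball x (r : R) : compact [set z | enorm (z - x) <= r].
Proof.
apply: bounded_closed_compact.
  exists (`|x| + r); split; first exact: num_real.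
  move=> s rs z /= zx; apply: ltW; apply: le_lt_trans rs.
  rewrite -[z in `|z|](subrK x) addrC (le_trans (ler_normD _ _))// lerD2l.
  exact: le_trans (norm_le_enorm _) zx.
have -> : [set z | enorm (z - x) <= r] =
          (fun z => enorm (z - x)) @^-1` [set a | a <= r] by [].
apply: preimage_closed; last exact: closed_le.
by move=> z _; exact: enormB_continuous.
Qed.

End EuclideanGeometry.

(** * Criteria for subgradients and subderivatives *)

Section SubdifferentialCriteria.
Variables (R : realType) (n : nat).
Implicit Types (f : 'rV[R]_n -> \bar R) (u v w x y z : 'rV[R]_n).

Lemma regular_subdiff_fin f z v : regular_subdiff f z v -> f z \is a fin_num.
Proof. by case. Qed.

(** A quadratic error term is absorbed by any linear one near z. *)
Lemma proximal_regular_subdiff f z v (C d : R) :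
    f z \is a fin_num -> 0 <= C -> 0 < d ->
    (forall z', enorm (z' - z) < d ->
       (f z + (dot v (z' - z) - C * enorm (z' - z) ^+ 2)%:E <= f z')%E) ->
  regular_subdiff f z v.
Proof.
move=> fz C0 d0 fv; split=> //.
apply/lee_addgt0Pr => e e0.
rewrite -leeBlDr// sub0e limf_einfE.
pose r := Num.min d (e / (C + 1)).
have C1 : 0 < C + 1 by rewrite ltr_wpDl.
have r0 : 0 < r by rewrite lt_min d0 divr_gt0.
pose V := [set z' | z' != z /\ enorm (z' - z) < r].
have FV : z^' V.
  apply/nbhs_enorm; exists r => // z' zz' z'z; by split.
apply: le_trans (ereal_sup_ubound _); last by exists V.
apply: le_ereal_inf_tmp => _ [z' [z'z zr] <-].
have N0 : 0 < enorm (z' - z) by rewrite enorm_gt0// subr_eq0.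
move: zr; rewrite lt_min => /andP[zd ze].
have := fv _ zd; move: (dot v (z' - z)) N0 ze => D.
set N := enorm _ => N0; rewrite ltr_pdivlMr// => ze.
case: (f z) fz => [a||]// _; case: (f z') => [b||]//=; last first.
  by move=> _; rewrite gt0_mulye ?leey// lte_fin invr_gt0.
rewrite -EFinD lee_fin => ab.
rewrite -!EFinB -EFinM lee_fin ler_pdivlMr//.
by nra.
Qed.

(** The lower limit runs jointly over t and w', so its positivity gives a linear
    growth rate that is uniform over a neighbourhood of the direction w, that
    is, on a cone with nonempty interior. *)
Lemma subderivative_gt0 f x w : f x \is a fin_num ->
    (0 < subderivative f x w)%E ->
  exists2 e : R, 0 < e & exists2 d : R, 0 < d &
    forall t w', 0 < t -> t < d -> enorm (w' - w) < d ->
      (f x + (e * t)%:E <= f (x + t *: w')%R)%E.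
Proof.
move=> fx; rewrite /subderivative limf_einfE => /ereal_sup_gt[y [V [[P Q]/=]]].
move=> [/nbhs_ballP[r /= r0 rP] /nbhs_enorm[s s0 sQ]] PQV <-{y} h.
(* The infimum may be +oo, in which case any rate e will do. *)
have [e e0 eh] : exists2 e : R, 0 < e & (e%:E <= ereal_inf
    [set ((f (x + p.1 *: p.2)%R - f x) * (p.1^-1)%:E)%E | p in V])%E.
  move: h; move: (ereal_inf _) => [a||]// h; first by exists a.
  by exists 1; rewrite ?leey.
exists e => //; exists (Num.min r s); first by rewrite lt_min r0.
move=> t w' t0; rewrite !lt_min => /andP[tr ts] /andP[wr ws].
have /(le_trans eh) : (ereal_inf
    [set ((f (x + p.1 *: p.2)%R - f x) * (p.1^-1)%:E)%E | p in V] <=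
    (f (x + t *: w')%R - f x) * (t^-1)%:E)%E.
  apply: ereal_inf_lbound; exists (t, w') => //; apply: PQV; split => /=.
    by apply: rP => //; rewrite /ball/= sub0r normrN gtr0_norm.
  exact: sQ.
case: (f x) fx => [a||]// _; case: (f _) => [b||]//=.
- by rewrite -EFinB -EFinM !lee_fin ler_pdivlMr// -lerBrDl.
- by rewrite leey.
- by rewrite gt0_mulNye ?lte_fin ?invr_gt0.
Qed.

End SubdifferentialCriteria.

(** * Minima of lower semicontinuous functions *)

Section LowerSemicontinuity.
Variable R : realType.

Definition lsc_on (T : topologicalType) (K : set T) (phi : T -> R) :=
  forall x a, K x -> a < phi x -> \forall y \near x, K y -> a < phi y.

(** If there were no minimum, the sublevel sets of phi would form a filter base
    on K, and each point of K would have a neighbourhood on which phi exceeds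
    all values taken far enough along this filter.  By compactness a single
    element of the filter serves all of K, in particular its own points. *)
Lemma lsc_on_attains_min (T : topologicalType) (K : set T) (phi : T -> R) :
    compact K -> K !=set0 -> lsc_on K phi ->
  exists2 x, K x & forall y, K y -> phi x <= phi y.
Proof.
move=> cK [x0 Kx0] lscphi; apply: contrapT => nomin.
pose F := filter_from K (fun y => [set y' | K y' /\ phi y' <= phi y]).
have FF : Filter F.
  apply: filter_from_filter; first by exists x0.
  move=> i j Ki Kj; case: (leP (phi i) (phi j)) => ij.
    by exists i => // y [Ky yi]; split; split=> //; exact: le_trans yi ij.
  exists j => // y [Ky yj]; split; split=> //.
  by apply: le_trans yj _; exact: ltW.
have /near_covering_withinP/(_ T F (fun y x => phi y < phi x) FF) :=
  (compact_near_coveringP K).1 cK.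
case=> [x Kx|y Ky yK].
  have [y Ky yx] : exists2 y, K y & phi y < phi x.
    apply: contrapT => hx; apply: nomin; exists x => // y Ky.
    by rewrite leNgt; apply/negP => yx; apply: hx; exists y.
  exists ([set x' | K x' -> phi y < phi x'], [set y' | K y' /\ phi y' <= phi y]).
    by split => /=; [exact: lscphi|exists y].
  move=> [x' y'] /= [Kx' [_ y'y]] /Kx'; exact: le_lt_trans.
by have /(_ y Ky) := yK y (conj Ky (lexx _)); rewrite ltxx.
Qed.

Lemma lsc_onD_continuous (T : topologicalType) (K : set T) (phi G : T -> R) :
  lsc_on K phi -> continuous G -> lsc_on K (fun x => phi x + G x).
Proof.
move=> lscphi cG x a Kx ax.
pose g := (phi x + G x - a) / 2.
have g0 : 0 < g by rewrite divr_gt0// subr_gt0.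
have /(lscphi _ _ Kx) h1 : phi x - g < phi x by rewrite ltrBlDr ltrDl.
have /cvgrPdist_lt/(_ g g0) h2 := cG x.
near=> y => Ky.
have h3 : phi x - g < phi y by move: Ky; near: y.
have : `|G x - G y| < g by near: y.
rewrite /g in h3 *; rewrite ltr_norml => /andP[h4 h5]; lra.
Unshelve. all: by end_near. Qed.

Lemma lsc_on_comp (T U : topologicalType) (K : set T) (L : set U)
    (g : T -> U) (phi : U -> R) :
  lsc_on L phi -> continuous g -> (forall x, K x -> L (g x)) ->
  lsc_on K (phi \o g).
Proof.
move=> lscphi cg KL x a Kx ax.
have h : \forall y \near g x, L y -> a < phi y by apply: lscphi ax; exact: KL.
by have := cg x _ h; rewrite /nbhs/=; apply: filterS => y hy /KL; exact: hy.
Qed.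

(** The truncation of f at the level f x + e turns local lower semicontinuity,
    which only concerns the level sets of f up to that level, into lower
    semicontinuity of a real-valued function on a whole ball.  It agrees
    with f wherever it is below that level. *)
Lemma locally_lsc_truncation n (f : 'rV[R]_n -> \bar R) x :
    (forall z, (-oo < f z)%E) -> locally_lsc f x ->
  exists2 e : R, 0 < e & exists2 phi : 'rV[R]_n -> R,
    forall z, (phi z)%:E = Order.min (f z) (f x + e%:E)%E &
    lsc_on [set z | enorm (z - x) <= e] phi.
Proof.
move=> fNy [fx [e e0 lscf]]; exists e => //.
pose phi z := fine (Order.min (f z) (f x + e%:E)%E).
have phiE z : (phi z)%:E = Order.min (f z) (f x + e%:E)%E.
  rewrite fineK//; case: (leP (f z)) => [fz|_]; last by rewrite fin_numD fx.
  by rewrite fin_real// fNy/= (le_lt_trans fz)// ltey_eq fin_numD fx.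
exists phi; first exact: phiE.
move=> z a Kz az.
have {az} : (a%:E < Order.min (f z) (f x + e%:E))%E by rewrite -phiE lte_fin.
rewrite lt_min => /andP[az ax].
have /closed_openC : closed [set z | enorm (z - x) <= e /\ (f z <= a%:E)%E].
  by apply: lscf; exact: ltW.
move=> oC.
have : open_nbhs z (~` [set z | enorm (z - x) <= e /\ (f z <= a%:E)%E]).
  by split=> // -[_]; rewrite leNgt az.
move/open_nbhs_nbhs; apply: filterS => y /= hy Ky.
rewrite -lte_fin phiE lt_min ax andbT ltNge; apply/negP => fya; exact: hy.
Qed.

End LowerSemicontinuity.

(** * Circular cones *)

Section SteepSubgradients.
Variables (R : realType) (n : nat).
Implicit Types (f : 'rV[R]_n -> \bar R) (u v w x y z : 'rV[R]_n) (q : R).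

(** For a unit vector w, the cone of the vectors whose angle with w has cosine
    at least (1 - q) / (1 + q).  This aperture is chosen so that the cone
    contains the ball of radius q around w ([round_cone_ball]) and is contained
    in the cone over the ball of squared radius 16 q around w when q is at most
    1 / 2 ([round_cone_direction]). *)
Definition round_cone w q : set 'rV[R]_n :=
  [set y | (1 - q) * enorm y <= (1 + q) * dot y w].

Lemma round_coneD w q y z : q <= 1 ->
  round_cone w q y -> round_cone w q z -> round_cone w q (y + z).
Proof.
rewrite /round_cone/= => q1 yD zD; rewrite dotDl mulrDr.
apply: le_trans (lerD yD zD).
by rewrite -mulrDr ler_wpM2l ?subr_ge0// enormD.
Qed.

Lemma round_coneZ w q (s : R) y : 0 <= s ->
  round_cone w q y -> round_cone w q (s *: y).
Proof.
rewrite /round_cone/= => s0 yD.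
rewrite dotZl enormZ ger0_norm// !(mulrCA _ s).
exact: ler_wpM2l.
Qed.

Lemma round_cone_ball w q b : dot w w = 1 -> 0 <= q -> q <= 1 ->
  enorm b <= 1 -> round_cone w q (w + q *: b).
Proof.
rewrite /round_cone/= => w1 q0 q1 b1.
have ew : enorm w = 1 by rewrite /enorm w1 sqrtr1.
have h1 : enorm (w + q *: b) <= 1 + q.
  rewrite (le_trans (enormD _ _))// ew lerD2l enormZ ger0_norm//.
  by rewrite ler_piMr.
have h2 : 1 - q <= dot (w + q *: b) w.
  rewrite dotDl w1 dotZl lerD2l -mulrN1 ler_wpM2l//.
  have := cauchy_schwarz (- b) w; rewrite dotNl enormN ew; lra.
rewrite mulrC; apply: le_trans (_ : (1 + q) * (1 - q) <= _).
  by rewrite ler_wpM2r// subr_ge0.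
by rewrite ler_wpM2l// addr_ge0.
Qed.

Lemma round_cone_direction w q y : dot w w = 1 -> 0 <= q -> q <= 1 / 2 ->
    round_cone w q y -> y != 0 ->
  0 < dot y w /\ enorm ((dot y w)^-1 *: y - w) ^+ 2 <= 16 * q.
Proof.
rewrite /round_cone/= => w1 q0 q2 yD y0.
have N0 := enorm_gt0 y0.
have t0 : 0 < dot y w by nra.
split=> //; rewrite enorm_sqr.
set u := _ *: y.
have uw : dot u w = 1 by rewrite dotZl mulVf// gt_eqF.
have uD : round_cone w q u by apply: round_coneZ => //; rewrite invr_ge0 ltW.
move: u uw uD => {}u uw; rewrite /round_cone/= uw mulr1 => uD.
rewrite !dotE (dotC w u) uw w1 -enorm_sqr.
have := enorm_ge0 u; move: (enorm u) uD => N uD N0'.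
have : ((1 - q) * N) ^+ 2 <= (1 + q) ^+ 2.
  by rewrite ler_pXn2r// nnegrE; nra.
rewrite exprMn; move: (N ^+ 2) => m h.
have [m1|m1] := leP m 1; first lra.
have : 0 <= (m - 1) * ((1 - q) ^+ 2 - 1 / 4) by apply: mulr_ge0; [lra|nra].
nra.
Qed.

Lemma round_cone_closed w q x : closed [set z | round_cone w q (z - x)].
Proof.
have -> : [set z | round_cone w q (z - x)] =
    (fun z => (1 - q) * enorm (z - x) - (1 + q) * dot (z - x) w) @^-1`
    [set a | a <= 0].
  by apply/seteqP; split=> z /=; rewrite /round_cone/= subr_le0.
apply: preimage_closed; last exact: closed_le.
by move=> z _; exact: (cvgB (cvgM (cvg_cst _) (@enormB_continuous _ _ x z))
                          (cvgM (cvg_cst _) (@dotB_continuous _ _ x w z))).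
Qed.

(** If p is a point nearest to z in a truncation of the cone x + D, then z - p is
    in the polar cone of D.  As D contains a ball of radius q around w, the
    polar cone lies in the half-space of the d with <d, w> <= - q |d|. *)
Lemma cone_projection_polar w q (x z p : 'rV[R]_n) (r : R) :
    dot w w = 1 -> 0 <= q -> q <= 1 ->
    round_cone w q (p - x) -> enorm (p - x) < r ->
    (forall p', round_cone w q (p' - x) -> enorm (p' - x) <= r ->
      enorm (z - p) ^+ 2 <= enorm (z - p') ^+ 2) ->
  dot (z - p) w <= - q * enorm (z - p).
Proof.
move=> w1 q0 q1 pD pr pmin.
have [zp|zp] := eqVneq (z - p) 0; first by rewrite zp dot0l enorm0 mulr0.
set d := z - p in zp *; have N0 := enorm_gt0 zp.
pose b := (enorm d)^-1 *: d.
have b1 : enorm b <= 1.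
  by rewrite enormZ ger0_norm ?invr_ge0 ?enorm_ge0// mulVf// gt_eqF.
have db : dot d b = enorm d.
  by rewrite dotZr -enorm_sqr expr2 mulrA mulVf ?mul1r// gt_eqF.
set e := w + q *: b; have eD : round_cone w q e by exact: round_cone_ball.
have e2 : enorm e <= 2.
  rewrite (le_trans (enormD _ _))// enormZ ger0_norm//.
  by rewrite /(enorm w) w1 sqrtr1; nra.
(* Otherwise moving p along e, which stays in the cone, gets closer to z. *)
rewrite leNgt; apply/negP => dw.
have Q0 : 0 < dot d e by rewrite dotDr dotZr db; lra.
pose s := Num.min ((r - enorm (p - x)) / 2) (dot d e / 4).
have s0 : 0 < s by rewrite lt_min !divr_gt0// subr_gt0.
have sr : s * 2 <= r - enorm (p - x) by rewrite -ler_pdivlMr// ge_min lexx.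
have sQ : s * 4 <= dot d e by rewrite -ler_pdivlMr// ge_min lexx orbT.
have E : p + s *: e - x = (p - x) + s *: e by rewrite addrAC.
have := pmin (p + s *: e); rewrite E => /(_ _ _)/wrap[].
  by apply: round_coneD => //; apply: round_coneZ => //; exact: ltW.
  rewrite (le_trans (enormD _ _))// enormZ gtr0_norm//.
  by rewrite -lerBrDl (le_trans _ sr)// ler_pM2l.
have -> : z - (p + s *: e) = d - s *: e by rewrite opprD addrA.
rewrite -/d; clearbody s e b d.
rewrite !enorm_sqr !dotE (dotC e d) -(enorm_sqr e).
have e22 : enorm e ^+ 2 <= 4 by have := enorm_ge0 e; nra.
have : s * (s * enorm e ^+ 2) <= s * (s * 4) by rewrite !ler_pM2l.
have : s * (s * 4) <= s * dot d e by rewrite ler_pM2l.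
have : 0 < s * dot d e by rewrite mulr_gt0.
lra.
Qed.

End SteepSubgradients.

(** * Minimization with a conical penalty *)

Section PenalizedMinimization.
Variables (R : realType) (n : nat).
Implicit Types (f : 'rV[R]_n -> \bar R) (u v w x y z p : 'rV[R]_n).

Lemma subderivative_gt0_cone f x w : f x \is a fin_num -> dot w w = 1 ->
    (0 < subderivative f x w)%E ->
  exists e q r : R, [/\ 0 < e, 0 < q <= 1 / 2, 0 < r &
    forall p, round_cone w q (p - x) -> enorm (p - x) <= r ->
      (f x + (e * dot (p - x) w)%:E <= f p)%E].
Proof.
move=> fx w1 /(subderivative_gt0 fx)[e e0 [d d0 fe]].
exists e, (Num.min (1 / 2) (d ^+ 2 / 32)), (d / 2).
set q := Num.min _ _.
have d2 : 0 < d ^+ 2 by rewrite exprn_gt0.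
have q0 : 0 < q by rewrite lt_min; apply/andP; split; lra.
have q2 : q <= 1 / 2 by rewrite ge_min lexx.
have qd : q <= d ^+ 2 / 32 by rewrite ge_min lexx orbT.
split=> //; [by rewrite q0|by rewrite divr_gt0|move=> p pD pd].
have [px|px] := eqVneq (p - x) 0.
  by rewrite px dot0l mulr0 adde0 -[p](subrK x) px add0r.
have [t0 dirp] := round_cone_direction w1 (ltW q0) q2 pD px.
have := fe (dot (p - x) w) ((dot (p - x) w)^-1 *: (p - x)) t0.
rewrite scalerA divff ?gt_eqF// scale1r [x + _]addrC subrK; apply.
  have ew : enorm w = 1 by rewrite /enorm w1 sqrtr1.
  by have := cauchy_schwarz (p - x) w; rewrite ew; lra.
rewrite -(ltr_pXn2r (n:=2)) ?nnegrE ?enorm_ge0 ?ltW//.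
by apply: le_lt_trans dirp _; lra.
Qed.

(** Off the diagonal the penalty k |z - p|^2 wins for large k.  At a diagonal
    point (z, z) the point z is in the cone, where phi grows at the rate e while
    the linear term only takes away e / 2, so the objective exceeds its value at
    (x, x) unless z = x.  By compactness some k forces every minimizer to be
    close to (x, x). *)
Lemma penalized_minimizer (phi : 'rV[R]_n -> R) x w (e q r eta : R) :
    dot w w = 1 -> 0 < e -> 0 < eta <= r ->
    0 <= q <= 1 / 2 ->
    lsc_on [set z | enorm (z - x) <= r] phi ->
    (forall p, round_cone w q (p - x) -> enorm (p - x) <= r ->
      phi x + e * dot (p - x) w <= phi p) ->
  exists (k : R) z p, [/\ 0 < k,
    enorm (z - x) < eta /\ phi x - eta < phi z,
    enorm (p - x) < eta /\ round_cone w q (p - x) &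
    forall z' p', enorm (z' - x) <= r -> enorm (p' - x) <= r ->
      round_cone w q (p' - x) ->
      phi z - e / 2 * dot (z - x) w + k * enorm (z - p) ^+ 2 <=
      phi z' - e / 2 * dot (z' - x) w + k * enorm (z' - p') ^+ 2].
Proof.
move=> w1 e0 /andP[eta0 etar] /andP[q0 q2] lscphi growth.
have r0 : 0 < r by exact: lt_le_trans etar.
have ew : enorm w = 1 by rewrite /enorm w1 sqrtr1.
pose B := [set z | enorm (z - x) <= r].
pose D := B `&` [set p | round_cone w q (p - x)].
pose G (k : R) (s : 'rV[R]_n * 'rV[R]_n) :=
  - (e / 2 * dot (s.1 - x) w) + k * enorm (s.1 - s.2) ^+ 2.
have c1 (s0 : 'rV[R]_n * 'rV[R]_n) : s.1 @[s --> s0] --> s0.1 by exact: cvg_fst.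
have c2 (s0 : 'rV[R]_n * 'rV[R]_n) : s.2 @[s --> s0] --> s0.2 by exact: cvg_snd.
have cE1 : continuous (fun s : 'rV[R]_n * 'rV[R]_n => enorm (s.1 - x)).
  by move=> s; exact: (cvg_comp _ _ (c1 s) (@enormB_continuous _ _ x _)).
have cE2 : continuous (fun s : 'rV[R]_n * 'rV[R]_n => enorm (s.2 - x)).
  by move=> s; exact: (cvg_comp _ _ (c2 s) (@enormB_continuous _ _ x _)).
have cW : continuous (fun s : 'rV[R]_n * 'rV[R]_n => dot (s.1 - x) w).
  by move=> s; exact: (cvg_comp _ _ (c1 s) (@dotB_continuous _ _ x w _)).
have cN : continuous (fun s : 'rV[R]_n * 'rV[R]_n => enorm (s.1 - s.2)).
  by move=> s; exact: (enorm_cvg (cvgB (c1 s) (c2 s))).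
have cG k : continuous (G k).
  move=> s; apply: (cvgD (cvgN (cvgM (cvg_cst _) (cW s)))).
  exact: (cvgM (cvg_cst _) (cvgM (cN s) (cN s))).
have cK : compact (B `*` D).
  apply: compact_setX; first exact: compact_eball.
  apply: compact_closedI; [exact: compact_eball|exact: round_cone_closed].
have lscK : lsc_on (B `*` D) (fun s => phi s.1).
  by apply: (@lsc_on_comp _ _ _ _ _ (fst : 'rV[R]_n * 'rV[R]_n -> _) _ lscphi) =>
    [s|s [] //]; exact: c1.
have Kxx : (B `*` D) (x, x).
  have Bx : B x by rewrite /B/= subrr enorm0 ltW.
  by split=> //; split=> //=; rewrite /round_cone/= subrr enorm0 dot0l !mulr0.
(* P k s: either s is as close to (x, x) as required, or s is no minimizer. *)
pose P (k : nat) (s : 'rV[R]_n * 'rV[R]_n) :=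
  [/\ enorm (s.1 - x) < eta, phi x - eta < phi s.1 & enorm (s.2 - x) < eta] \/
  phi x < phi s.1 + G k%:R s.
have [k [k0 kP]] : exists k : nat, (0 < k)%N /\ B `*` D `<=` P k.
  have /near_covering_withinP/(_ nat \oo P _) :=
    (compact_near_coveringP (B `*` D)).1 cK.
  case=> [[z0 p0] Kz0|N _ NP]; last first.
    by exists N.+1; split=> //; apply: NP => /=.
  move: Kz0; have [<-{p0}|zp] := eqVneq z0 p0.
    have [-> _|z0x Kz0] := eqVneq z0 x.
      exists ([set s | ((B `*` D) s -> phi x - eta < phi s.1) /\
        (enorm (s.1 - x) < eta /\ enorm (s.2 - x) < eta)], setT).
        split; last exact: filterT.
        apply: filterI; first by apply: lscK => //=; lra.
        apply: filterI.
          by apply: (cvgr_lt _ (cE1 _)); rewrite subrr enorm0.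
        by apply: (cvgr_lt _ (cE2 _)); rewrite subrr enorm0.
      by move=> [s k] /= [[h1 [h2 h3]] _] Ks; left; split=> //; exact: h1.
    have [_ [z0r z0D]] := Kz0; have := growth _ z0D z0r.
    have [|t0 _] := round_cone_direction w1 q0 q2 z0D; first by rewrite subr_eq0.
    have et0 := mulr_gt0 e0 t0; set t := dot _ _ in t0 et0 * => gz0.
    exists ([set s | ((B `*` D) s -> phi z0 - e * t / 8 < phi s.1) /\
      dot (s.1 - x) w < 5 / 4 * t], setT).
      split; last exact: filterT.
      apply: filterI; first by apply: lscK => //=; lra.
      by apply: (cvgr_lt _ (cW _)); rewrite -/t; lra.
    move=> [s k] /= [[h1 h2] _] /h1 h; right; rewrite /G.
    have : 0 <= k%:R * enorm (s.1 - s.2) ^+ 2 by rewrite mulr_ge0 ?sqr_ge0.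
    have : e * dot (s.1 - x) w < e * (5 / 4 * t) by rewrite ltr_pM2l.
    lra.
  move=> Kz0; have N0 : 0 < enorm (z0 - p0) by rewrite enorm_gt0// subr_eq0.
  set N := enorm _ in N0.
  pose C := (phi x - phi z0 + 1 + e / 2 * r) / (N / 2) ^+ 2.
  exists ([set s | ((B `*` D) s -> phi z0 - 1 < phi s.1) /\
      N / 2 < enorm (s.1 - s.2)], [set k | C < k%:R]).
    split; last exact: nbhs_infty_gtr.
    apply: filterI; first by apply: lscK => //=; lra.
    by apply: (cvgr_gt _ (cN _)); rewrite -/N; lra.
  move=> [s k] /= [[h1 h2] Ck] Ks; have h := h1 Ks; right; rewrite /G.
  move: Ck; rewrite ltr_pdivrMr ?exprn_gt0//; last by lra.
  have : dot (s.1 - x) w <= r.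
    have := cauchy_schwarz (s.1 - x) w; rewrite ew mulr1 => /le_trans; apply.
    by case: Ks.
  rewrite -(ler_pM2l e0) => ds Ck.
  have : k%:R * (N / 2) ^+ 2 <= k%:R * enorm (s.1 - s.2) ^+ 2.
    by rewrite ler_wpM2l// ler_pXn2r ?nnegrE ?enorm_ge0// ?ltW//; lra.
  lra.
have lscF := lsc_onD_continuous lscK (cG k%:R).
have [[z p] [zB [pB pD]] zpmin] := lsc_on_attains_min cK (ex_intro _ _ Kxx) lscF.
have GKxx : phi x + G k%:R (x, x) = phi x.
  by rewrite /G/= !subrr dot0l enorm0 expr0n/= !mulr0 oppr0 !addr0.
have [zx phiz px] : [/\ enorm (z - x) < eta, phi x - eta < phi z
    & enorm (p - x) < eta].
  have := zpmin _ Kxx; rewrite GKxx => zpx.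
  by case: (kP (z, p) (conj zB (conj pB pD))) => [//|]; rewrite ltNge zpx.
exists k%:R, z, p; rewrite ltr0n; split=> // z' p' z'r p'r p'D.
by have := zpmin (z', p') (conj z'r (conj p'r p'D)); rewrite /G/= !addrA.
Qed.

End PenalizedMinimization.

(** * Steep subgradients *)

Section SubderivativeBound.
Variables (R : realType) (n : nat).
Implicit Types (f : 'rV[R]_n -> \bar R) (u v w x y z p : 'rV[R]_n).

(** First-order conditions at a minimizer (z, p) of the penalized problem.
    Minimality in z makes v = (e / 2) w - 2 k (z - p) a regular subgradient at
    z; minimality in p puts z - p in the polar cone, so that - (z - p) has with
    w an inner product at least q |z - p|.  Hence <v, w> is bounded below by
    e / 2 and by q |v|, up to constants.  The uniformity in |v| is what
    keeps the inequality meaningful when v is unbounded. *)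
Lemma steep_subgradients f x w :
    (forall z, (-oo < f z)%E) -> locally_lsc f x -> dot w w = 1 ->
    (0 < subderivative f x w)%E ->
  exists2 c : R, 0 < c & forall eta : R, 0 < eta -> exists z v,
    [/\ enorm (z - x) < eta, (`|f z - f x| < eta%:E)%E,
        regular_subdiff f z v & c * (1 + enorm v) <= dot v w].
Proof.
move=> fNy lscf w1 dfw.
have fx : f x \is a fin_num by case: lscf.
have [e [q [s [e0 /andP[q0 q2] s0 growth]]]] := subderivative_gt0_cone fx w1 dfw.
have [h h0 [phi phiE lscphi]] := locally_lsc_truncation fNy lscf.
have ew : enorm w = 1 by rewrite /enorm w1 sqrtr1.
pose a := fine (f x); have fxE : f x = a%:E by rewrite fineK.
have phix : phi x = a.
  apply/EFin_inj; rewrite phiE fxE; apply: min_l.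
  by rewrite -EFinD lee_fin lerDl ltW.
have phif z : ((phi z)%:E <= f z)%E by rewrite phiE ge_min lexx.
have fphi z : phi z < a + h -> f z = (phi z)%:E.
  rewrite -lte_fin phiE fxE -EFinD => fzh; rewrite min_l//.
  by move: fzh; rewrite gt_min ltxx orbF => /ltW.
(* The bound e r <= h keeps the linear growth below the truncation level. *)
pose r := Num.min h (Num.min s (h / e)).
have r0 : 0 < r by rewrite !lt_min h0 s0 divr_gt0.
have rh : r <= h by rewrite ge_min lexx.
have rs : r <= s by rewrite !ge_min lexx orbT.
have re : e * r <= h by rewrite mulrC -ler_pdivlMr// !ge_min lexx !orbT.
have lscr : lsc_on [set z | enorm (z - x) <= r] phi.
  move=> z b /= zr bz; have := lscphi z b (le_trans zr rh) bz.
  by apply: filterS => y hy /= yr; apply: hy; exact: le_trans yr rh.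
have growthphi p : round_cone w q (p - x) -> enorm (p - x) <= r ->
    phi x + e * dot (p - x) w <= phi p.
  move=> pD pr; rewrite -lee_fin phiE phix le_min fxE -EFinD !lee_fin lerD2l.
  have := growth p pD (le_trans pr rs); rewrite fxE -EFinD => -> /=.
  apply: le_trans re; rewrite ler_pM2l//.
  by have := cauchy_schwarz (p - x) w; rewrite ew; lra.
clearbody r.
exists (Num.min (e / 4) (q / 2)); first by rewrite lt_min !divr_gt0.
set c := Num.min _ _ => eta eta0.
pose eta' := Num.min (Num.min eta (eta / (e + 1))) (Num.min r (h / (e + 1))).
have e1 : 0 < e + 1 by rewrite addr_gt0.
have eta'0 : 0 < eta' by rewrite !lt_min eta0 r0 !divr_gt0.
have eta'r : eta' <= r by rewrite !ge_min lexx !orbT.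
have eta'e : eta' <= eta by rewrite !ge_min lexx.
have eta'1 : eta' * (e + 1) <= eta.
  by rewrite -ler_pdivlMr// !ge_min lexx !orbT.
have eta'2 : eta' * (e + 1) <= h.
  by rewrite -ler_pdivlMr// !ge_min lexx !orbT.
have [||k [z [p [k0 [zeta phiz] [peta pD] zpmin]]]] :=
  @penalized_minimizer _ _ phi x w e q r eta' w1 e0 _ _ lscr growthphi.
- by rewrite eta'0.
- by rewrite ltW.
have zr : enorm (z - x) < r by exact: lt_le_trans eta'r.
have pr : enorm (p - x) < r by exact: lt_le_trans eta'r.
have phizle : phi z <= a + e / 2 * eta'.
  have xr : enorm (x - x) <= r by rewrite subrr enorm0 ltW.
  have xD : round_cone w q (x - x).
    by rewrite /round_cone/= subrr enorm0 dot0l !mulr0.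
  have := zpmin x x xr xr xD; rewrite subrr dot0l enorm0 phix.
  have : 0 <= k * enorm (z - p) ^+ 2 by rewrite mulr_ge0 ?sqr_ge0// ltW.
  have : e * dot (z - x) w <= e * eta'.
    rewrite ler_pM2l//.
    by have := cauchy_schwarz (z - x) w; rewrite ew; lra.
  rewrite expr0n/=; lra.
have fzE : f z = (phi z)%:E by apply: fphi; nra.
pose v := (e / 2) *: w - (2 * k) *: (z - p).
have zp : dot (z - p) w <= - q * enorm (z - p).
  apply: (@cone_projection_polar _ _ w q x z p r) => //; [exact: ltW|lra|].
  move=> p' p'D p'r; have := zpmin z p' (ltW zr) p'r p'D.
  by rewrite lerD2l ler_pM2l.
exists z, v; split.
- exact: lt_le_trans zeta eta'e.
- rewrite fzE fxE -EFinB abse_EFin lte_fin ltr_norml; rewrite phix in phiz.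
  by apply/andP; split; nra.
- apply: (@proximal_regular_subdiff _ _ f z v k (r - enorm (z - x))).
  + by rewrite fzE.
  + exact: ltW.
  + by rewrite subr_gt0.
  + move=> z' z'z; apply: le_trans (phif z'); rewrite fzE -EFinD lee_fin.
    have z'r : enorm (z' - x) <= r.
      rewrite -(subrK z z') -addrA (le_trans (enormD _ _))//.
      by rewrite -lerBrDr ltW.
    have := zpmin z' p z'r (ltW pr) pD.
    have -> : z' - p = (z - p) + (z' - z) by rewrite [RHS]addrC addrA subrK.
    have -> : z' - x = (z - x) + (z' - z) by rewrite [RHS]addrC addrA subrK.
    rewrite /v; move: (z' - z) (z - p) (z - x) => d1 d2 d3.
    rewrite !enorm_sqr !dotE (dotC d1 d2) (dotC w d1); lra.
- have -> : dot v w = e / 2 - 2 * k * dot (z - p) w by rewrite !dotE w1 mulr1.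
  have : enorm v <= e / 2 + 2 * k * enorm (z - p).
    rewrite (le_trans (enormD _ _))// enormN !enormZ ew mulr1 !gtr0_norm//.
    - by rewrite mulr_gt0.
    - by rewrite divr_gt0.
  have := enorm_ge0 v; have := enorm_ge0 (z - p); have := ler_wpM2l (ltW k0) zp.
  have ce : c <= e / 4 by rewrite ge_min lexx.
  have cq : c <= q / 2 by rewrite ge_min lexx orbT.
  move: (enorm v) (enorm (z - p)) (dot (z - p) w) => N m t h1 m0 N0 Nm.
  have : c * (1 + N) <= e / 4 + q / 2 * N.
    by rewrite mulrDr mulr1 lerD// ler_wpM2r.
  have : q / 2 * N <= q / 2 * (e / 2 + 2 * k * m).
    by rewrite ler_wpM2l// divr_ge0// ltW.
  have : q * e <= 1 / 2 * e by rewrite ler_pM2r.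
  have : 0 <= q * (k * m) by rewrite !mulr_ge0// ltW.
  lra.
Qed.

End SubderivativeBound.

(** * An upper bound for the subderivative *)

Section Subsequences.
Variable R : realType.

Lemma harmonic_lt (e : R) : 0 < e -> \forall j \near \oo, (j.+1%:R : R)^-1 < e.
Proof.
move=> e0; have := nbhs_infty_gtr e^-1; apply: filterS => j ej.
rewrite -(invrK e) ltf_pV2 ?posrE ?invr_gt0//.
by rewrite (lt_trans ej)// ltr_nat.
Qed.

Lemma cvg_abseP (T : Type) (F : set_system T) {FF : Filter F}
    (g : T -> \bar R) (a : \bar R) : a \is a fin_num ->
  g t @[t --> F] --> a <->
  forall e : R, 0 < e -> \forall t \near F, (`|g t - a| < e%:E)%E.
Proof.
case: a => [a||]// _.
have ltE t (e : R) : g t \is a fin_num ->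
    (`|g t - a%:E| < e%:E)%E = (`|a - fine (g t)| < e).
  by case: (g t) => [b||]// _; rewrite -EFinB abse_EFin lte_fin distrC.
split=> [/fine_cvgP[gfin /cvgrPdist_lt ga] e e0|ga].
  by apply: filterS2 gfin (ga e e0) => t gt; rewrite ltE.
have fing t (e : R) : (`|g t - a%:E| < e%:E)%E -> g t \is a fin_num.
  by case: (g t).
apply/fine_cvgP; split; first by apply: filterS (ga 1 ltr01) => t; exact: fing.
apply/cvgrPdist_lt => e e0; apply: filterS (ga e e0) => t gt.
by rewrite -ltE//; exact: fing gt.
Qed.

Lemma compact_subsequence (T : pseudoMetricType R) (K : set T) (u : nat -> T) :
    compact K -> (forall j, K (u j)) ->
  exists2 p, K p & exists2 s : nat -> nat,
    s j @[j --> \oo] --> \oo & u (s j) @[j --> \oo] --> p.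
Proof.
move=> cK Ku; have [|p [Kp clp]] := cK (u j @[j --> \oo]) _.
  by exists 0 => // j _; exact: Ku.
exists p => //.
have /choice[s sP] : forall j, exists k,
    (j <= k)%N /\ ball p (j.+1%:R^-1 : R) (u k).
  move=> j; have [||_ [[k jk <-] pk]] :=
    clp [set u k | k in [set k | (j <= k)%N]] (ball p (j.+1%:R^-1 : R)).
  - by exists j => // k jk; exists k.
  - by apply: nbhsx_ballx; rewrite invr_gt0.
  - by exists k.
exists s.
  move=> A [N _ NA]; exists N => // j /= Nj; apply: NA => /=.
  by apply: leq_trans Nj _; case: (sP j).
apply/cvg_ballP => e e0; have := harmonic_lt e0; apply: filterS => j je.
by apply: le_ball (sP j).2; exact: ltW.
Qed.

End Subsequences.

Section SubderivativeUpperBound.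
Variables (R : realType) (n : nat).
Implicit Types (f : 'rV[R]_n -> \bar R) (u v w x y z p : 'rV[R]_n).

Lemma regular_limiting_subdiff f z v :
  regular_subdiff f z v -> limiting_subdiff f z v.
Proof.
move=> fzv; split; first exact: regular_subdiff_fin fzv.
exists (fun=> z), (fun=> v); split.
- exact: (@cvg_cst _ z).
- exact: (@cvg_cst _ (f z)).
- by move=> _.
- exact: (@cvg_cst _ v).
Qed.

(** The scalings 1 / (1 + |v|) of the steep subgradients v have a limit l' along
    a subsequence, and so have the scaled subgradients.  If l' > 0 the v
    converge to a limiting subgradient; if l' = 0 the scaled ones converge to a
    horizon subgradient. *)
Lemma subderivative_le0 f x w :
    (forall z, (-oo < f z)%E) -> locally_lsc f x -> dot w w = 1 ->
    (forall v, limiting_subdiff f x v -> dot v w <= 0) ->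
    (forall v, horizon_subdiff f x v -> dot v w <= 0) ->
  (subderivative f x w <= 0)%E.
Proof.
move=> fNy lscf w1 limw horw; rewrite leNgt; apply/negP => dfw.
have fx : f x \is a fin_num by case: lscf.
have [c c0 steep] := steep_subgradients fNy lscf w1 dfw.
have /choice[zv zvP] : forall j : nat, exists zv : 'rV[R]_n * 'rV[R]_n,
    [/\ enorm (zv.1 - x) < j.+1%:R^-1, (`|f zv.1 - f x| < (j.+1%:R^-1)%:E)%E,
        regular_subdiff f zv.1 zv.2 & c * (1 + enorm zv.2) <= dot zv.2 w].
  move=> j; have [|z [v h]] := steep j.+1%:R^-1; first by rewrite invr_gt0.
  by exists (z, v).
pose z j := (zv j).1; pose v j := (zv j).2.
have zx : z j @[j --> \oo] --> x.
  apply/cvg_enormP => e e0; have := harmonic_lt e0; apply: filterS => j.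
  by apply: lt_trans; case: (zvP j).
have fzx : f (z j) @[j --> \oo] --> f x.
  apply/cvg_abseP => // e e0; have := harmonic_lt e0; apply: filterS => j je.
  have [_ + _ _] := zvP j; move/lt_le_trans; apply; rewrite lee_fin; exact: ltW.
have regzv j : regular_subdiff f (z j) (v j) by case: (zvP j).
have steepv j : c * (1 + enorm (v j)) <= dot (v j) w by case: (zvP j).
pose l j := (1 + enorm (v j))^-1.
have l0 j : 0 < l j by rewrite invr_gt0 ltr_pwDl// enorm_ge0.
have l1 j : l j <= 1 by rewrite invf_le1 ?ltr_pwDl ?enorm_ge0// lerDl enorm_ge0.
have lv1 j : enorm (l j *: v j) <= 1.
  rewrite enormZ gtr0_norm// mulrC ler_pdivrMr ?ltr_pwDl ?enorm_ge0//.
  by rewrite mul1r lerDr.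
have [|[l' u] /= [l'01 _] [s soo lucvg]] :=
  @compact_subsequence R (R * 'rV[R]_n)%type
    (`[0, 1] `*` [set z | enorm (z - 0) <= 1]) (fun j => (l j, l j *: v j))
    (compact_setX (@segment_compact _ _ _) (@compact_eball _ _ 0 1)).
  by move=> j; split=> /=; rewrite ?subr0// in_itv/= l1 ltW.
have lcvg : l (s j) @[j --> \oo] --> l'.
  have fstP : p.1 @[p --> (l', u)] --> l' by exact: cvg_fst.
  exact: (cvg_comp _ _ lucvg fstP).
have ucvg : l (s j) *: v (s j) @[j --> \oo] --> u.
  have sndP : p.2 @[p --> (l', u)] --> u by exact: cvg_snd.
  exact: (cvg_comp _ _ lucvg sndP).
have uw : c <= dot u w.
  apply: (cvgr_to_ge (dot_cvg ucvg (cvg_cst w))).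
  apply: nearW => j; rewrite dotZl mulrC ler_pdivlMr//.
  by rewrite ltr_pwDl ?enorm_ge0.
have zsx : z (s j) @[j --> \oo] --> x by exact: (cvg_comp _ _ soo zx).
have fzsx : f (z (s j)) @[j --> \oo] --> f x by exact: (cvg_comp _ _ soo fzx).
move: l'01; rewrite /= in_itv/= => /andP[+ _].
rewrite le_eqVlt => /orP[/eqP l'0|l'0].
  have : horizon_subdiff f x u.
    split=> //; exists (z \o s), (v \o s), (l \o s); split=> //.
    - by move=> j; apply: regular_limiting_subdiff; exact: regzv.
    - by split; [move=> j; exact: l0|rewrite [X in _ --> X]l'0].
  by move/horw; lra.
have : limiting_subdiff f x (l'^-1 *: u).
  split; first exact: fx.
  exists (z \o s), (v \o s); split; [exact: zsx|exact: fzsx| |].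
    by move=> j; exact: regzv.
  have : (l (s j))^-1 *: (l (s j) *: v (s j)) @[j --> \oo] --> l'^-1 *: u.
    by apply: cvgZ ucvg; apply: cvgV lcvg; rewrite gt_eqF.
  by under eq_fun do rewrite scalerA mulVf ?gt_eqF// scale1r.
move/limw; rewrite dotZl pmulr_rle0 ?invr_gt0//; lra.
Qed.

(** At a regular point with subgradient 0, the horizon subgradients are
    recession directions of the subdifferential, and going one unit from 0 in
    such a direction reaches a subgradient. *)
Lemma regular_subderivative_le0 f x w :
    (forall z, (-oo < f z)%E) -> regular_at f x -> limiting_subdiff f x 0 ->
    dot w w = 1 -> (forall v, limiting_subdiff f x v -> dot v w <= 0) ->
  (subderivative f x w <= 0)%E.
Proof.
move=> fNy [lscf limreg horrec] f0 w1 limw; apply: subderivative_le0 => // v.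
rewrite horrec => /(_ 0 1); rewrite -limreg => /(_ f0 ler01).
by rewrite add0r scale1r; exact: limw.
Qed.

End SubderivativeUpperBound.

(** * Strict differentiability *)

Section StrictDifferentiability.
Variables (R : realType) (n m : nat).
Implicit Types (Psi : 'rV[R]_n -> 'rV[R]_m) (V : set 'rV[R]_n).

Lemma entries_le_norm (u : 'rV[R]_m) (c : R) :
  0 <= c -> (forall i, `|u 0 i| <= c) -> `|u| <= c.
Proof.
move=> c0 uc; rewrite [`|u|]/Num.norm/= mx_normrE; apply/bigmax_leP; split=> //.
by move=> [i j] _ /=; rewrite (ord1 i).
Qed.

(** The difference quotient of s |-> Psi (b + s c) at t is literally that of Psi
    at b + t c in the direction c. *)
Lemma is_derive_line Psi (b c : 'rV[R]_n) (t : R) i :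
  differentiable Psi (b + t *: c) ->
  is_derive t 1 (fun s : R => Psi (b + s *: c) 0 i) ('d Psi (b + t *: c) c 0 i).
Proof.
move=> dPsi.
have quot : (fun h : R => h^-1 *: ((Psi \o shift (b + t *: c)) (h *: c) -
      Psi (b + t *: c))) =
    (fun h : R => h^-1 *: (((fun s : R => Psi (b + s *: c)) \o shift t)
      (h *: (1 : R)) - Psi (b + t *: c))).
  apply/funext => h /=; congr (_ *: (Psi _ - _)).
  by rewrite [h *: 1]mulr1 scalerDl addrCA.
have dl : derivable (fun s : R => Psi (b + s *: c)) t 1.
  by rewrite /derivable -quot; exact: (diff_derivable dPsi).
split; first exact: ((derivable_mxP _ _ _).1 dl).
have := derive_mx dl.
rewrite [X in X = _]/derive -quot -/(derive _ _ _) deriveE// => ->.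
by rewrite mxE.
Qed.

(** The mean value theorem is applied to each coordinate along the segment from b
    to a; the sup norm makes coordinatewise bounds sufficient. *)
Lemma smooth_on_strictly_differentiable Psi V x (e : R) :
    open V -> V x -> smooth_on V Psi -> 0 < e ->
  exists2 r : R, 0 < r & forall a b, `|a - x| < r -> `|b - x| < r ->
    V a /\ `|Psi a - Psi b - 'd Psi x (a - b)| <= e * `|a - b|.
Proof.
move=> oV Vx [dV [L Llip]] e0.
have /nbhs_ballP[r0 /= r00 xV] : nbhs x V by exact: open_nbhs_nbhs.
have L0 : 0 < `|L| + 1 by rewrite ltr_wpDl.
exists (Num.min r0 (e / (`|L| + 1))); first by rewrite lt_min r00 divr_gt0.
set r := Num.min _ _.
have rV z : `|z - x| < r -> V z.
  move=> zr; apply: xV; rewrite -ball_normE /= distrC.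
  by apply: lt_le_trans zr _; rewrite ge_min lexx.
have re : (`|L| + 1) * r <= e by rewrite mulrC -ler_pdivlMr// ge_min lexx orbT.
move=> a b ar br; split; first exact: rV.
set c := a - b.
have inr (t : R) : t \in `[0, 1] -> `|b + t *: c - x| < r.
  rewrite in_itv/= => /andP[t0 t1].
  have -> : b + t *: c - x = t *: (a - x) + (1 - t) *: (b - x).
    rewrite /c scalerBl scale1r !scalerBr; apply/rowP => i; rewrite !mxE; ring.
  rewrite (le_lt_trans (ler_normD _ _))// !normrZ ger0_norm// ger0_norm ?subr_ge0//.
  have := ltW ar; have := ltW br.
  move: `|a - x| `|b - x| ar br => A B Ar Br Br' Ar'.
  have [->|t'] := eqVneq t 0; first by rewrite mul0r add0r subr0 mul1r.
  have : t * A < t * r by rewrite ltr_pM2l// lt_neqAle eq_sym t'.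
  have : (1 - t) * B <= (1 - t) * r by rewrite ler_wpM2l// subr_ge0.
  lra.
apply: entries_le_norm => [|i]; first by rewrite mulr_ge0// ltW.
pose g (t : R) := Psi (b + t *: c) 0 i.
pose dg (t : R) := 'd Psi (b + t *: c) c 0 i.
have gd (t : R) : t \in `[0, 1] -> is_derive t 1 g (dg t).
  by move=> t01; apply: is_derive_line; apply: dV; apply: rV; exact: inr.
have gd' (t : R) : t \in `]0, 1[ -> is_derive t 1 g (dg t).
  by move=> t01; apply: gd; exact: subset_itv_oo_cc t01.
have gc : {within `[0, 1], continuous g}.
  apply: derivable_within_continuous => t t01.
  by have [] := gd t t01.
have [t t01 gt] := MVT (@ltr01 R) gd' gc.
have t01' : t \in `[0, 1] by exact: subset_itv_oo_cc t01.
have entryB (A B D1 D2 : 'rV[R]_m) : A 0 i - B 0 i = D1 0 i ->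
    (A - B - D2) 0 i = (D1 - D2) 0 i.
  by move=> AB; rewrite !mxE AB.
have ba : b + 1 *: c = a by rewrite scale1r addrC subrK.
have gt' : Psi a 0 i - Psi b 0 i = 'd Psi (b + t *: c) c 0 i.
  by move: gt; rewrite /g /dg ba scale0r addr0 subr0 mulr1.
rewrite (entryB _ _ _ _ gt').
apply: le_trans (entry_le_norm _ _) _.
have tr := inr t t01'.
apply: (le_trans (Llip _ _ c (rV _ tr) Vx)).
rewrite ler_wpM2r//; apply: le_trans re.
apply: (@le_trans _ _ ((`|L| + 1) * `|b + t *: c - x|)).
  by rewrite ler_wpM2r//; have := ler_norm L; lra.
by rewrite ler_pM2l// ltW.
Qed.

End StrictDifferentiability.

(** * Projection along a normal space *)

Section NormalProjection.
Variables (R : realType) (n m : nat).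

Lemma dot_mulmx k (u v : 'rV[R]_k) : dot u v = (u *m v^T) 0 0.
Proof. by rewrite mxE; apply: eq_bigr => i _; rewrite mxE. Qed.

Lemma mulmx_norm_le k l (B : 'M[R]_(k, l)) :
  exists2 c : R, 0 < c & forall y : 'rV[R]_k, `|y *m B| <= c * `|y|.
Proof.
pose c : R := \sum_i \sum_j `|B i j|.
have c0 : 0 <= c by apply: sumr_ge0 => i _; apply: sumr_ge0.
exists (c + 1) => [|y]; first by rewrite ltr_wpDl.
apply: entries_le_norm => [|j]; first by rewrite mulr_ge0// addr_ge0.
rewrite mxE (le_trans (ler_norm_sum _ _ _))//.
apply: (@le_trans _ _ (c * `|y|)); last by rewrite ler_wpM2r// lerDl.
rewrite /c mulr_suml; apply: ler_sum => i _.
rewrite normrM mulrC ler_pM// ?entry_le_norm//.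
by rewrite (bigD1 j)//= lerDl sumr_ge0.
Qed.

(** If y A^T A = 0 then |y A^T|^2 = 0, so y is orthogonal to the range of A, which
    is everything. *)
Lemma gram_unitmx (A : 'M[R]_(n, m)) :
  (forall y : 'rV[R]_m, exists u : 'rV[R]_n, u *m A = y) -> A^T *m A \in unitmx.
Proof.
move=> surjA; rewrite -row_free_unit -kermx_eq0; apply/rowV0P => y /sub_kermxP yG.
have yA : y *m A^T = 0.
  apply: enorm_eq0; rewrite /enorm dot_mulmx trmx_mul trmxK mulmxA.
  by rewrite -(mulmxA y) yG mul0mx mxE sqrtr0.
have [u uy] := surjA y.
apply: enorm_eq0; rewrite /enorm dot_mulmx -{2}uy trmx_mul mulmxA yA.
by rewrite mul0mx mxE sqrtr0.
Qed.

(** The fixed point is a minimizer of |T y - y| on the compact ball: applying T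
    once more would halve this quantity. *)
Lemma contraction_on_ball (T : 'rV[R]_m -> 'rV[R]_m) (s : R) : 0 <= s ->
    (forall y, `|y| <= s -> `|T y| <= s) ->
    (forall y y', `|y| <= s -> `|y'| <= s -> `|T y - T y'| <= 1 / 2 * `|y - y'|) ->
  exists2 y, `|y| <= s & T y = y.
Proof.
move=> s0 Ts Tc; pose U := [set y : 'rV[R]_m | `|y| <= s].
have cU : compact U.
  apply: bounded_closed_compact.
    exists s; split; first exact: num_real.
    by move=> c sc y /le_trans; apply; exact: ltW.
  rewrite (_ : U = closed_ball_ Num.norm 0 s); first exact: closed_closed_ball_.
  by apply/seteqP; split=> y; rewrite /U/closed_ball_/= sub0r normrN.
have lscT : lsc_on U (fun y => `|T y - y|).
  move=> y a Uy ay; pose e := `|T y - y| - a.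
  have e0 : 0 < e by rewrite subr_gt0.
  apply/nbhs_ballP; exists (e / 2); first by rewrite /= divr_gt0.
  move=> y'; rewrite -ball_normE /= => yy' Uy'.
  have := Tc _ _ Uy Uy'.
  have := ler_distD (T y') (T y) y; have := ler_distD y' (T y') y.
  by rewrite (distrC y' y); rewrite /e in yy'; lra.
have U0 : U !=set0 by exists 0; rewrite /U/= normr0.
have [y Uy ymin] := lsc_on_attains_min cU U0 lscT.
exists y => //; have UTy : U (T y) by exact: Ts.
have := Tc _ _ UTy Uy; have := ymin _ UTy => h1 h2.
by apply/eqP; rewrite -subr_eq0 -normr_le0; lra.
Qed.

(** With A the matrix of 'd Psi x, the normal space is the set of the y A^T, and
    Psi (z - y A^T) = 0 is solved for y by the Newton map
      T y = y + Psi (z - y A^T) (A^T A)^-1,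
    whose derivative at y = 0, z = x is 0: strict differentiability makes it a
    contraction.  In contrast with the nearest point of M, the point
    p = z - y A^T has z - p normal at x itself, rather than at p. *)
Lemma normal_projection (M V : set 'rV[R]_n) (x : 'rV[R]_n)
    (Psi : 'rV[R]_n -> 'rV[R]_m) (eta : R) :
    local_equation M x V Psi -> M x -> 0 < eta ->
  exists2 d : R, 0 < d & forall z, enorm (z - x) < d -> exists p,
    [/\ M p, enorm (p - x) < eta &
        forall u, 'd Psi x u = 0 -> dot (z - p) u = 0].
Proof.
move=> [oV Vx smV surjV MV] Mx eta0.
have dPsix : differentiable Psi x by case: smV => + _; exact.
have Psix : Psi x = 0.
  have : (M `&` V) x by split.
  by rewrite MV => -[].
pose A := lin1_mx ('d Psi x).
have AE u : u *m A = 'd Psi x u by rewrite mul_rV_lin1.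
have Gunit : A^T *m A \in unitmx.
  apply: gram_unitmx => y; have : range ('d Psi x) y by rewrite surjV.
  by case=> u _ uy; exists u; rewrite AE.
clearbody A.
pose B := invmx (A^T *m A).
have [a a0 aP] := mulmx_norm_le A^T; have [b b0 bP] := mulmx_norm_le B.
have ab0 : 0 < 2 * (b * a) by rewrite !mulr_gt0.
have e0 : 0 < (2 * (b * a))^-1 by rewrite invr_gt0.
have [r0 r00 strict] := smooth_on_strictly_differentiable oV Vx smV e0.
(* Radii are measured in the sup norm; the factor n%:R converts them back. *)
pose r := Num.min r0 (eta / (n%:R + 1)).
have n1 : 0 < n%:R + 1 :> R by rewrite ltr_wpDl.
have r_gt0 : 0 < r by rewrite lt_min r00 divr_gt0.
have rr0 : r <= r0 by rewrite ge_min lexx.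
have reta : r * (n%:R + 1) <= eta by rewrite -ler_pdivlMr// ge_min lexx orbT.
clearbody r.
pose s := r / 2 / a.
have s0 : 0 < s by rewrite /s; apply: divr_gt0 => //; apply: divr_gt0.
have s2b : 0 < s / (2 * b) by apply: divr_gt0 => //; exact: mulr_gt0.
have : nbhs x [set z | `|Psi z| < s / (2 * b)].
  have := differentiable_continuous dPsix; move/cvgrPdist_lt/(_ _ s2b).
  apply: filterS => z.
  by rewrite Psix sub0r normrN.
move=> /nbhs_enorm[d d0 dP].
exists (Num.min d (r / 2)) => [|z]; first by rewrite lt_min d0 divr_gt0.
rewrite lt_min => /andP[zd zr].
have near_x y : `|y| <= s -> `|z - y *m A^T - x| < r.
  move=> ys; rewrite addrAC (le_lt_trans (ler_normB _ _))//.
  have := norm_le_enorm (z - x); have := aP y.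
  have : a * `|y| <= r / 2 by rewrite mulrC -ler_pdivlMr.
  lra.
pose T y := y + Psi (z - y *m A^T) *m B.
have Tc y y' : `|y| <= s -> `|y'| <= s -> `|T y - T y'| <= 1 / 2 * `|y - y'|.
  move=> ys y's; pose p := z - y *m A^T; pose p' := z - y' *m A^T.
  have [_ st] := strict p p' (lt_le_trans (near_x _ ys) rr0)
                             (lt_le_trans (near_x _ y's) rr0).
  have pp' : p - p' = - ((y - y') *m A^T).
    rewrite /p /p' mulmxBl; move: (y *m A^T) (y' *m A^T) => Y Y'.
    by apply/rowP => i; rewrite !mxE; ring.
  have -> : T y - T y' = (Psi p - Psi p' - 'd Psi x (p - p')) *m B.
    rewrite -AE pp' mulNmx opprK -(mulmxA (y - y')) mulmxDl.
    rewrite -(mulmxA (y - y')) (mulmxV Gunit) mulmx1 mulmxBl /T -/p -/p'.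
    move: (Psi p *m B) (Psi p' *m B) => Y Y'.
    by apply/rowP => i; rewrite !mxE; ring.
  apply: (le_trans (bP _)); rewrite -(ler_pM2l b0) in st.
  apply: (le_trans st); rewrite pp' normrN.
  have h := aP (y - y'); rewrite -(ler_pM2l b0) -(ler_pM2l e0) in h.
  rewrite [leLHS]mulrCA (le_trans h)// le_eqVlt; apply/orP; left; apply/eqP.
  by field; rewrite !gt_eqF.
have Ts y : `|y| <= s -> `|T y| <= s.
  move=> ys; have s0' : `|0 : 'rV[R]_m| <= s by rewrite normr0 ltW.
  have T0 : `|T 0| <= s / 2.
    rewrite /T add0r mul0mx subr0 (le_trans (bP _))//.
    by have := dP _ zd => /=; rewrite ltr_pdivlMr ?mulr_gt0//; lra.
  have := Tc y 0 ys s0'; rewrite subr0.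
  have := ler_normD (T y - T 0) (T 0); rewrite subrK; lra.
have [y ys Ty] := contraction_on_ball (ltW s0) Ts Tc.
have Psiy : Psi (z - y *m A^T) = 0.
  have PB : Psi (z - y *m A^T) *m B = 0 by apply: (addrI y); rewrite addr0.
  by rewrite -[LHS]mulmx1 -(mulVmx Gunit) mulmxA PB mul0mx.
have pr := near_x _ ys.
exists (z - y *m A^T); split.
- have [Vp _] := strict _ _ (lt_le_trans pr rr0) (lt_le_trans pr rr0).
  have : (M `&` V) (z - y *m A^T) by rewrite MV.
  by case.
- apply: le_lt_trans (enorm_le_norm _) _.
  apply: (@le_lt_trans _ _ (n%:R * r)); first by rewrite ler_wpM2l// ltW.
  by apply: lt_le_trans reta; rewrite mulrC ltr_pM2l// ltrDl.
- move=> u; rewrite -AE => uA.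
  rewrite opprB addrCA subrr addr0 dotC dot_mulmx trmx_mul trmxK mulmxA uA.
  by rewrite mul0mx mxE.
Qed.

End NormalProjection.

(** * Relative interior and identification *)

Section RelativeInterior.
Variables (R : realType) (n : nat).
Implicit Types (C : set 'rV[R]_n) (u v w : 'rV[R]_n).

(** All multiples of u, including the negative ones, are in the affine hull of C,
    which contains 0 and u. *)
Lemma relint0_scale C u : relint C 0 -> C u ->
  exists2 e : R, 0 < e & forall t, `|t| < e -> C (t *: u).
Proof.
move=> [C0 /nbhs_enorm[d d0 dC]] Cu.
have u1 : 0 < enorm u + 1 by rewrite ltr_wpDl// enorm_ge0.
exists (d / (enorm u + 1)) => [|t td]; first exact: divr_gt0.
apply: dC.
  rewrite subr0 enormZ; apply: (@le_lt_trans _ _ (`|t| * (enorm u + 1))).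
    by rewrite ler_wpM2l// lerDl.
  by rewrite -ltr_pdivlMr.
move=> D [affD CD]; have := affD 0 u t (CD _ C0) (CD _ Cu).
by rewrite scaler0 add0r.
Qed.

Lemma relint0_orthogonal C w (d : R) : relint C 0 -> 0 < d ->
    (forall u, C u -> enorm u < d -> dot u w <= 0) ->
  forall u, C u -> dot u w = 0.
Proof.
move=> riC d0 Cw u Cu; have [e e0 eC] := relint0_scale riC Cu.
have u1 : 0 < enorm u + 1 by rewrite ltr_wpDl// enorm_ge0.
pose t := Num.min (e / 2) (d / (enorm u + 1) / 2).
have t0 : 0 < t by rewrite lt_min; apply/andP; split; do !apply: divr_gt0 => //.
have te : t < e by rewrite gt_min; apply/orP; left; lra.
have td : t * enorm u < d.
  have : t * (enorm u + 1) <= d / 2.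
    by rewrite -ler_pdivlMr// mulrAC ge_min lexx orbT.
  lra.
have h1 : dot (t *: u) w <= 0.
  by apply: Cw; [apply: eC; rewrite gtr0_norm|rewrite enormZ gtr0_norm].
have h2 : dot (- t *: u) w <= 0.
  by apply: Cw; [apply: eC; rewrite normrN gtr0_norm
                |rewrite enormZ normrN gtr0_norm].
move: h1 h2; rewrite !dotZl mulNr oppr_le0 pmulr_rle0// pmulr_rge0// => h1 h2.
by apply/eqP; rewrite eq_le h1 h2.
Qed.

End RelativeInterior.

Section Identification.
Variables (R : realType) (n : nat).
Implicit Types (f : 'rV[R]_n -> \bar R) (M : set 'rV[R]_n).
Implicit Types (u v w x y z p : 'rV[R]_n).

Lemma edist_to0_ge0 (C : set 'rV[R]_n) : (0 <= edist_to 0 C)%E.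
Proof. by apply: le_ereal_inf_tmp => _ [y _ <-]; rewrite lee_fin enorm_ge0. Qed.

(** Inner semicontinuity speaks of sequences that lie entirely in M, so the
    finitely many terms outside M are first replaced by x. *)
Lemma inner_semicontinuous_edist_cvg0 (S : 'rV[R]_n -> set 'rV[R]_n) M x
    (x_ : nat -> 'rV[R]_n) :
    M x -> inner_semicontinuous S M x -> S x 0 ->
    x_ k @[k --> \oo] --> x -> (\forall k \near \oo, M (x_ k)) ->
  edist_to 0 (S (x_ k)) @[k --> \oo] --> 0%E.
Proof.
move=> Mx isc Sx0 xx Mk.
pose x' k := if `[< M (x_ k) >] then x_ k else x.
have x'E : \forall k \near \oo, x' k = x_ k.
  by apply: filterS Mk => k Mxk; rewrite /x' asboolT.
have Mx' k : M (x' k) by rewrite /x'; case: asboolP.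
have x'x : x' k @[k --> \oo] --> x.
  apply/cvg_enormP => e e0; have /cvg_enormP/(_ e e0) := xx.
  by apply: filterS2 x'E => k ->.
have [ys Sys ys0] := isc x' 0 Mx' x'x Sx0.
apply/cvg_abseP => // e e0; have /cvg_enormP/(_ e e0) := ys0.
apply: filterS3 x'E Sys => k -> Sk yk.
rewrite sube0 gee0_abs ?edist_to0_ge0//.
rewrite -lte_fin in yk; apply: le_lt_trans yk.
by apply: ereal_inf_lbound; exists (ys k).
Qed.

Lemma edist_to0_lt (C : set 'rV[R]_n) (e : R) : (edist_to 0 C < e%:E)%E ->
  exists2 v, C v & enorm v < e.
Proof.
move=> /ereal_inf_lt[_ [v Cv <-]]; rewrite lte_fin subr0 => ve.
by exists v.
Qed.

Lemma restricted_smooth_near f M x : M x -> restricted_smooth f M x ->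
  forall e : R, 0 < e -> \forall z \near x, M z -> (`|f z - f x| < e%:E)%E.
Proof.
move=> Mx [V [g [oV Vx [dg _] fg]]] e e0.
have gx : g z @[z --> x] --> g x.
  by apply: differentiable_continuous; exact: dg.
move/cvgrPdist_lt/(_ e e0) : gx.
have : nbhs x V by exact: open_nbhs_nbhs.
apply: filterS2 => z Vz gz Mz.
by rewrite !fg// -EFinB abse_EFin lte_fin distrC.
Qed.

(** The sum of the prox-regularity inequalities at the two points, each tested
    at the other one: the values of f cancel. *)
Lemma prox_regular_monotone f x vbar : prox_regular_for f x vbar ->
  exists2 rho : R, 0 < rho & exists2 d : R, 0 < d & forall z v p u,
    enorm (z - x) < d -> (`|f z - f x| < d%:E)%E ->
    enorm (p - x) < d -> (`|f p - f x| < d%:E)%E ->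
    limiting_subdiff f z v -> enorm (v - vbar) < d ->
    limiting_subdiff f p u -> enorm (u - vbar) < d ->
    dot (u - v) (z - p) <= rho * enorm (z - p) ^+ 2.
Proof.
move=> [_ _ _ [rho rho0 [d d0 prox]]].
exists rho => //; exists d => // z v p u zx fz px fp fzv vd fpu ud.
have := prox z p v zx px fz fzv vd; have := prox p z u px zx fp fpu ud.
case: fzv fpu => [+ _] [+ _]; case: (f z) => [a||]// _; case: (f p) => [b||]// _.
rewrite -!EFinD !lee_fin (enormB p z).
have -> : p - z = - (z - p) by rewrite opprB.
by rewrite dotNr dotBl; lra.
Qed.

Lemma vanishing_subgradient_off_manifold f M x (x_ : nat -> 'rV[R]_n)
    (eta : R) (P : 'rV[R]_n -> Prop) :
    f x \is a fin_num -> x_ k @[k --> \oo] --> x ->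
    f (x_ k) @[k --> \oo] --> f x ->
    edist_to 0 (limiting_subdiff f (x_ k)) @[k --> \oo] --> 0%E ->
    ~ (\forall k \near \oo, M (x_ k)) -> (\forall z \near x, P z) -> 0 < eta ->
  exists z v, [/\ ~ M z, P z, (`|f z - f x| < eta%:E)%E,
    limiting_subdiff f z v & enorm v < eta].
Proof.
move=> fx xx fxx dist0 nM Px eta0; apply: contrapT => none; apply: nM.
have /(cvg_abseP _ fx)/(_ _ eta0) := fxx.
have /(cvg_abseP _ (_ : 0%E \is a fin_num))/(_ eta eta0) := dist0.
move=> /(_ isT); have : \forall k \near \oo, P (x_ k) := xx _ Px.
apply: filterS3 => k Pk; rewrite sube0 gee0_abs ?edist_to0_ge0// => dk fk.
have [v fv ve] := edist_to0_lt dk.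
by apply: contrapT => nMk; apply: none; exists (x_ k), v.
Qed.

(** The vector w is a limit of the directions from points p of M to points z off
    M; the bound on u comes from [prox_regular_monotone] divided by the distance
    from p to z. *)
Lemma off_manifold_normal_direction f M x (x_ : nat -> 'rV[R]_n) :
    manifold_around M x -> restricted_smooth f M x ->
    inner_semicontinuous (limiting_subdiff f) M x ->
    prox_regular_for f x 0 ->
    x_ k @[k --> \oo] --> x -> f (x_ k) @[k --> \oo] --> f x ->
    edist_to 0 (limiting_subdiff f (x_ k)) @[k --> \oo] --> 0%E ->
    ~ (\forall k \near \oo, M (x_ k)) ->
  exists w, [/\ normal_space_at M x w, dot w w = 1 &
    exists2 d : R, 0 < d & forall u, limiting_subdiff f x u -> enorm u < d ->
      dot u w <= 0].
Proof.
move=> [Mx [m [V [Psi loc]]]] fsmooth isc prox xx fxx dist0 nM.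
have fx : f x \is a fin_num by case: prox.
have [rho rho0 [d d0 mono]] := prox_regular_monotone prox.
have /choice[q qP] : forall j : nat, exists q : 'rV[R]_n * 'rV[R]_n * 'rV[R]_n,
    let: (z, v, p) := q in
    [/\ ~ M z /\ M p, enorm (z - x) < j.+1%:R^-1 /\ enorm (p - x) < j.+1%:R^-1,
        (`|f z - f x| < (j.+1%:R^-1)%:E)%E,
        limiting_subdiff f z v /\ enorm v < j.+1%:R^-1 &
        forall u, 'd Psi x u = 0 -> dot (z - p) u = 0].
  move=> j; have j0 : 0 < j.+1%:R^-1 :> R by rewrite invr_gt0.
  have [r r0 proj] := normal_projection loc Mx j0.
  pose r' := Num.min r j.+1%:R^-1.
  have r'0 : 0 < r' by rewrite lt_min r0.
  have nearx : \forall z \near x, enorm (z - x) < r'.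
    by apply/nbhs_enorm; exists r'.
  have [z [v [nMz zr fz fzv v0]]] :=
    vanishing_subgradient_off_manifold fx xx fxx dist0 nM nearx j0.
  move: zr; rewrite lt_min => /andP[zr zj].
  by have [p [Mp px pu]] := proj z zr; exists (z, v, p).
pose z j := (q j).1.1; pose v j := (q j).1.2; pose p j := (q j).2.
have {}qP j : [/\ ~ M (z j) /\ M (p j),
    enorm (z j - x) < j.+1%:R^-1 /\ enorm (p j - x) < j.+1%:R^-1,
    (`|f (z j) - f x| < (j.+1%:R^-1)%:E)%E,
    limiting_subdiff f (z j) (v j) /\ enorm (v j) < j.+1%:R^-1 &
    forall u, 'd Psi x u = 0 -> dot (z j - p j) u = 0].
  by have := qP j; rewrite /z /v /p; case: (q j) => -[].
pose N j := enorm (z j - p j).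
have N0 j : 0 < N j.
  have [[nMz Mp] _ _ _ _] := qP j; apply: enorm_gt0; rewrite subr_eq0.
  by apply/eqP => zp; apply: nMz; rewrite zp.
pose w j := (N j)^-1 *: (z j - p j).
have w1 j : dot (w j) (w j) = 1.
  by rewrite -enorm_sqr enormZ gtr0_norm ?invr_gt0// mulVf ?expr1n// gt_eqF.
have [|w' _ [s soo ww']] :=
  @compact_subsequence R 'rV[R]_n _ w (@compact_eball _ _ 0 1).
  by move=> j; rewrite /= subr0 /enorm w1 sqrtr1.
have zx : z j @[j --> \oo] --> x.
  apply/cvg_enormP => e e0; have := harmonic_lt e0; apply: filterS => j.
  by apply: lt_trans; case: (qP j) => _ [].
have px : p j @[j --> \oo] --> x.
  apply/cvg_enormP => e e0; have := harmonic_lt e0; apply: filterS => j.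
  by apply: lt_trans; case: (qP j) => _ [].
have v0 : v j @[j --> \oo] --> (0 : 'rV[R]_n).
  apply/cvg_enormP => e e0; have := harmonic_lt e0; apply: filterS => j.
  by rewrite subr0; apply: lt_trans; case: (qP j) => _ _ _ [].
have fz : f (z j) @[j --> \oo] --> f x.
  apply/cvg_abseP => // e e0; have := harmonic_lt e0; apply: filterS => j je.
  by case: (qP j) => _ _ + _ _; move/lt_trans; apply; rewrite lte_fin.
exists w'; split.
- exists m, V, Psi; split=> // u u0.
  have : dot (w (s j)) u @[j --> \oo] --> dot w' u.
    exact: (dot_cvg ww' (cvg_cst u)).
  have -> : (fun j => dot (w (s j)) u) = fun=> 0.
    apply/funext => j; rewrite dotZl; case: (qP (s j)) => _ _ _ _ /(_ u u0) ->.
    by rewrite mulr0.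
  by move=> h; exact: (cvg_unique (@Rhausdorff R) h (cvg_cst _)).
- have : dot (w (s j)) (w (s j)) @[j --> \oo] --> dot w' w'.
    exact: (dot_cvg ww' ww').
  under eq_fun do rewrite w1.
  by move=> h; exact: (cvg_unique (@Rhausdorff R) h (cvg_cst _)).
exists d => // u fxu ud.
have psx : p (s j) @[j --> \oo] --> x by exact: (cvg_comp _ _ soo px).
have zsx : z (s j) @[j --> \oo] --> x by exact: (cvg_comp _ _ soo zx).
have Mps j : M (p (s j)) by case: (qP (s j)) => -[].
have fps : \forall j \near \oo, M (p (s j)) -> (`|f (p (s j)) - f x| < d%:E)%E.
  exact: (psx _ (restricted_smooth_near Mx fsmooth d0)).
have [us fus usu] := isc _ _ Mps psx fxu.
have Nw j : dot (us j - v (s j)) (z (s j) - p (s j)) =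
    N (s j) * dot (us j - v (s j)) (w (s j)).
  by rewrite dotZr mulrA divff ?mul1r// gt_eqF.
have lhs : dot (us j - v (s j)) (w (s j)) @[j --> \oo] --> dot (u - 0) w'.
  by apply: dot_cvg ww'; apply: cvgB usu _; exact: (cvg_comp _ _ soo v0).
have rhs : rho * N (s j) @[j --> \oo] --> rho * enorm (x - x).
  by apply: cvgM; [exact: cvg_cst|apply: enorm_cvg; exact: (cvgB zsx psx)].
rewrite subr0 in lhs; rewrite subrr enorm0 mulr0 in rhs.
apply: ler_cvg_to lhs rhs _.
have fzs : f (z (s j)) @[j --> \oo] --> f x by exact: (cvg_comp _ _ soo fz).
have vs0 : v (s j) @[j --> \oo] --> (0 : 'rV[R]_n) by exact: (cvg_comp _ _ soo v0).
have usd : enorm (us j) @[j --> \oo] --> enorm u by exact: (enorm_cvg usu).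
move/cvg_enormP/(_ d d0) in psx; move/cvg_enormP/(_ d d0) in zsx.
move/(cvg_abseP _ fx)/(_ d d0) in fzs; move/cvg_enormP/(_ d d0) in vs0.
move/cvgr_lt/(_ d ud) in usd.
near=> j.
rewrite -(ler_pM2l (N0 (s j))) -Nw mulrCA -expr2.
have [_ _ _ [fzv _] _] := qP (s j).
apply: mono => //; rewrite ?subr0; try by near: j.
- by move: (Mps j); near: j; exact: fps.
- by near: j; under eq_near do rewrite -[v _]subr0.
Unshelve. all: by end_near. Qed.

End Identification.

Theorem theorem3 (R : realType) (n : nat) (f : 'rV[R]_n -> \bar R)
    (M : set 'rV[R]_n) (xbar : 'rV[R]_n) (x_ : nat -> 'rV[R]_n)
    (f_gtNy : forall z, (-oo < f z)%E)
    (f_partly_smooth : partly_smooth f M xbar)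
    (f_prox_regular : prox_regular f xbar)
    (ri0 : relint (limiting_subdiff f xbar) 0)
    (x_cvg : x_ k @[k --> \oo] --> xbar)
    (fx_cvg : f (x_ k) @[k --> \oo] --> f xbar) :
  (\forall k \near \oo, M (x_ k)) <->
  edist_to 0 (limiting_subdiff f (x_ k)) @[k --> \oo] --> 0%E.
Proof.
have [f0 _] := ri0.
have [manM fsmooth fregular fsharp [_ isc]] := f_partly_smooth.
have [MX _] := manM.
split.
  by move=> Mk; exact: (inner_semicontinuous_edist_cvg0 MX isc f0 x_cvg Mk).
move=> dist0; apply: contrapT => nM.
have [w [normw w1 [d d0 fw]]] := off_manifold_normal_direction manM fsmooth isc
  (f_prox_regular 0 f0) x_cvg fx_cvg dist0 nM.
(* C lies in the hyperplane orthogonal to w, so both subderivatives are <= 0. *)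
have w_orth := relint0_orthogonal ri0 d0 fw.
have [freg _] := nbhs_singleton fregular MX.
have w0 : w != 0.
  by apply/eqP => w0; move: w1; rewrite w0 dot0l => /esym/eqP; rewrite oner_eq0.
have dfw : (subderivative f xbar w <= 0)%E.
  by apply: regular_subderivative_le0 => // v /w_orth ->.
have dfNw : (subderivative f xbar (- w)%R <= 0)%E.
  apply: regular_subderivative_le0 => //; first by rewrite dotNl dotNr opprK.
  by move=> v /w_orth vw; rewrite dotNr vw oppr0.
have := fsharp w normw w0; rewrite ltNge => /negP; apply.
by apply: le_trans dfNw _; rewrite oppe_ge0.
Qed.
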